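(* Let $\Omega\subset\mathbb{R}^2$ be a simply connected domain, let $p,q$ be complex valued functions on $\Omega$ with $p\in C^2(\Omega)$, $p\neq0$ in $\Omega$, let $u_0$ be a nonvanishing solution in $\Omega$ of $$(\operatorname{div}p\operatorname{grad}+q)u=0,\qquad(\ast)$$ and set $f=p^{1/2}u_0$. Let $$q_1=-\frac1p\left(\frac qp+2\left\langle\frac{\nabla p}{p},\frac{\nabla u_0}{u_0}\right\rangle+2\left(\frac{\nabla u_0}{u_0}\right)^2\right)$$ and consider the equation $$\left(\operatorname{div}\frac1p\operatorname{grad}+q_1\right)v=0\qquad\text{in }\Omega.\qquad(\ast\ast)$$ Let $u$ be a complex valued solution of $(\ast)$ in $\Omega$. Then a complex valued solution $v$ of $(\ast\ast)$ such that $W=p^{1/2}u+kp^{-1/2}v$ is a solution of the bicomplex Vekua equation $W_{\overline z}=\frac{f_{\overline z}}{f}\overline W$ in $\Omega$ is constructed according to the formula $$v=u_0^{-1}\,\overline A\left(kpu_0^2\,\partial_{\overline z}(u_0^{-1}u)\right),$$ and it is unique up to an additive term $cu_0^{-1}$, where $c$ is an arbitrary complex constant. Conversely, let $v$ be a complex valued solution of $(\ast\ast)$ in $\Omega$; then the corresponding solution $u$ of $(\ast)$ such that $W=p^{1/2}u+kp^{-1/2}v$ is a solution of $W_{\overline z}=\frac{f_{\overline z}}{f}\overline W$ in $\Omega$ is constructed according to the formula $$u=-u_0\,\overline A\left(kp^{-1}u_0^{-2}\,\partial_{\overline z}(u_0v)\right).$$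
   Context: Bicomplex numbers are elements $Q_1+Q_2k$ with $Q_1,Q_2\in\mathbb{C}=\{a+ib:a,b\in\mathbb{R}\}$, where $i^2=k^2=-1$ and $ik=ki$ (a commutative algebra); ''scalar'' means $Q_2=0$. Conjugation: $\overline{Q_1+Q_2k}=Q_1-Q_2k$. With real variables $x,y$ and $z=x+ky$, $\partial_{\overline z}=\frac12(\partial_x+k\partial_y)$, and a subscript $\overline z$ denotes application of $\partial_{\overline z}$. The operator $\operatorname{div}p\operatorname{grad}+q$ acts by $\varphi\mapsto\operatorname{div}(p\operatorname{grad}\varphi)+q\varphi$, and similarly with $1/p$, $q_1$. For complex vectors $a,b$: $\langle a,b\rangle=a_1b_1+a_2b_2$ (bilinear), $a^2=\langle a,a\rangle$. $p^{1/2}$ is one fixed twice continuously differentiable function on $\Omega$ whose square is $p$, and $p^{-1/2}=1/p^{1/2}$. For a bicomplex valued function $\Phi=\Phi_1+k\Phi_2$ ($\Phi_1,\Phi_2$ complex valued) on a simply connected domain with $\partial_y\Phi_1-\partial_x\Phi_2=0$, $\overline A[\Phi]$ denotes the family of scalar functions $$\overline A[\Phi](x,y)=2\int_\Gamma(\Phi_1\,dx+\Phi_2\,dy)+c,$$ where $\Gamma$ is any rectifiable curve in the domain from a fixed point $(x_0,y_0)$ to $(x,y)$ and $c$ is an arbitrary complex constant; it satisfies $\partial_{\overline z}\overline A[\Phi]=\Phi$. Solutions are understood in the classical sense, as twice continuously differentiable functions. *)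

(* Defs.v *)
(* Functions on a plane domain [Omega] are total functions of the two real
   coordinates; every condition below is imposed only at points of [Omega],
   and since [Omega] is open, the derivatives occurring there depend only on
   the values on [Omega]. *)
From Stdlib Require Import Reals.
From mathcomp Require seq.
From Coquelicot Require Import Coquelicot.

Open Scope R_scope.
Open Scope C_scope.

Record bicomplex : Type := BC { sc_part : C; vec_part : C }.

Definition scalar (c : C) : bicomplex := BC c 0.

Definition kunit : bicomplex := BC 0 1.

Definition bcplus (a b : bicomplex) : bicomplex :=
  BC (sc_part a + sc_part b) (vec_part a + vec_part b).

Definition bcmult (a b : bicomplex) : bicomplex :=
  BC (sc_part a * sc_part b - vec_part a * vec_part b)
     (sc_part a * vec_part b + vec_part a * sc_part b).

Definition bcconj (a : bicomplex) : bicomplex :=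
  BC (sc_part a) (- vec_part a).

Declare Scope bc_scope.
Delimit Scope bc_scope with BC.
Bind Scope bc_scope with bicomplex.
Infix "+" := bcplus : bc_scope.
Infix "*" := bcmult : bc_scope.

(* Coquelicot's [Derive] is total (with an arbitrary value where there is no
   derivative); [C_diff] below supplies the differentiability. *)
Definition Dx (g : R -> R -> C) (x y : R) : C :=
  (Derive (fun t => Re (g t y)) x, Derive (fun t => Im (g t y)) x).

Definition Dy (g : R -> R -> C) (x y : R) : C :=
  (Derive (fun t => Re (g x t)) y, Derive (fun t => Im (g x t)) y).

(* [g] is of class C^n on [Omega]: [ex_diff_n h n x y] asks for existence and
   continuity at [(x, y)] of all partial derivatives of [h] of order <= n. *)
Definition C_diff (n : nat) (Omega : R * R -> Prop) (g : R -> R -> C) : Prop :=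
  forall x y : R, Omega (x, y) ->
    ex_diff_n (fun a b => Re (g a b)) n x y /\
    ex_diff_n (fun a b => Im (g a b)) n x y.

Definition bcDx (W : R -> R -> bicomplex) (x y : R) : bicomplex :=
  BC (Dx (fun a b => sc_part (W a b)) x y) (Dx (fun a b => vec_part (W a b)) x y).

Definition bcDy (W : R -> R -> bicomplex) (x y : R) : bicomplex :=
  BC (Dy (fun a b => sc_part (W a b)) x y) (Dy (fun a b => vec_part (W a b)) x y).

Definition dzbar (W : R -> R -> bicomplex) (x y : R) : bicomplex :=
  (scalar (RtoC (1 / 2)%R) * (bcDx W x y + kunit * bcDy W x y))%BC.

Definition grad (g : R -> R -> C) (x y : R) : C * C := (Dx g x y, Dy g x y).

Definition div (F : R -> R -> C * C) (x y : R) : C :=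
  Dx (fun a b => fst (F a b)) x y + Dy (fun a b => snd (F a b)) x y.

Definition vscal (c : C) (a : C * C) : C * C := (c * fst a, c * snd a).

(* Bilinear: no complex conjugation. *)
Definition bilin (a b : C * C) : C := fst a * fst b + snd a * snd b.

Definition solution (Omega : R * R -> Prop) (p q u : R -> R -> C) : Prop :=
  C_diff 2 Omega u /\
  forall x y : R, Omega (x, y) ->
    div (fun a b => vscal (p a b) (grad u a b)) x y + q x y * u x y = 0.

Definition vekua_solution (Omega : R * R -> Prop) (f : R -> R -> C)
    (W : R -> R -> bicomplex) : Prop :=
  C_diff 2 Omega (fun x y => sc_part (W x y)) /\
  C_diff 2 Omega (fun x y => vec_part (W x y)) /\
  forall x y : R, Omega (x, y) ->
    dzbar W x y =
      (dzbar (fun a b => scalar (f a b)) x y * scalar (/ f x y)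
       * bcconj (W x y))%BC.

Definition unit_interval (t : R) : Prop := (0 <= t <= 1)%R.

Definition curve_in (Omega : R * R -> Prop) (gamma : R -> R * R) : Prop :=
  continuous_on unit_interval gamma /\
  forall t : R, unit_interval t -> Omega (gamma t).

Definition path_connected (Omega : R * R -> Prop) : Prop :=
  forall a b : R * R, Omega a -> Omega b ->
    exists gamma : R -> R * R,
      curve_in Omega gamma /\ gamma 0%R = a /\ gamma 1%R = b.

Definition null_homotopic (Omega : R * R -> Prop) (gamma : R -> R * R) : Prop :=
  exists H : R * R -> R * R,
    continuous_on
      (fun st : R * R => unit_interval (fst st) /\ unit_interval (snd st)) H /\
    (forall s t : R, unit_interval s -> unit_interval t -> Omega (H (s, t))) /\
    (forall t : R, unit_interval t -> H (0%R, t) = gamma t) /\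
    (forall t : R, unit_interval t -> H (1%R, t) = gamma 0%R) /\
    (forall s : R, unit_interval s ->
       H (s, 0%R) = gamma 0%R /\ H (s, 1%R) = gamma 0%R).

Definition simply_connected_domain (Omega : R * R -> Prop) : Prop :=
  open Omega /\ (exists a : R * R, Omega a) /\ path_connected Omega /\
  forall gamma : R -> R * R,
    curve_in Omega gamma -> gamma 0%R = gamma 1%R -> null_homotopic Omega gamma.

(* The inscribed polygons have bounded length. *)
Definition rectifiable (gamma : R -> R * R) : Prop :=
  exists L : R, forall (n : nat) (t : nat -> R),
    (forall i : nat, (i <= n)%nat -> (0 <= t i <= t (S i))%R /\ (t (S i) <= 1)%R) ->
    (sum_n (fun i => norm (minus (gamma (t (S i))) (gamma (t i)))) n <= L)%R.

(* Riemann-Stieltjes sum of [P dx + Q dy] along [gamma] over a tagged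
   subdivision; same recursion as Coquelicot's [Riemann_sum], with
   increments of the coordinates of [gamma] instead of increments of the
   parameter. *)
Definition line_sum (P Q : R -> R -> C) (gamma : R -> R * R)
    (ptd : @SF_seq R) : C :=
  seq.foldr Cplus 0
    (seq.pairmap
       (fun s t : R * R =>
          let z := gamma (snd t) in
          P (fst z) (snd z) * RtoC (fst (gamma (fst t)) - fst (gamma (fst s)))%R
          + Q (fst z) (snd z) * RtoC (snd (gamma (fst t)) - snd (gamma (fst s)))%R)
       (SF_h ptd, 0%R) (SF_t ptd)).

Definition is_line_integral (P Q : R -> R -> C) (gamma : R -> R * R)
    (I : C) : Prop :=
  filterlim (line_sum P Q gamma) (Riemann_fine 0 1) (locally I).

Definition compatible (Omega : R * R -> Prop) (Phi : R -> R -> bicomplex) : Prop :=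
  C_diff 1 Omega (fun x y => sc_part (Phi x y)) /\
  C_diff 1 Omega (fun x y => vec_part (Phi x y)) /\
  forall x y : R, Omega (x, y) ->
    Dy (fun a b => sc_part (Phi a b)) x y
    - Dx (fun a b => vec_part (Phi a b)) x y = 0.

(* [phi] is a member of the family A-bar[Phi] on [Omega] with base point
   [(x0, y0)]; the family is only defined for compatible [Phi]. *)
Definition Abar (Omega : R * R -> Prop) (x0 y0 : R) (Phi : R -> R -> bicomplex)
    (phi : R -> R -> C) : Prop :=
  compatible Omega Phi /\
  exists c : C, forall (x y : R) (gamma : R -> R * R),
    curve_in Omega gamma -> rectifiable gamma ->
    gamma 0%R = (x0, y0) -> gamma 1%R = (x, y) ->
    exists I : C,
      is_line_integral (fun a b => sc_part (Phi a b))
        (fun a b => vec_part (Phi a b)) gamma I /\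
      phi x y = 2 * I + c.

(* Main.v *)
Require Import Defs.
From mathcomp Require seq.
From Stdlib Require Import Reals Lra Lia Classical ClassicalEpsilon.
From Coquelicot Require Import Coquelicot.
(* [Reals] exports a lemma that is also called [Dx]. *)
Import Defs.

(** Write [a = p u0^2] and [U = u / u0]. Separating the scalar and vector parts
    of the Vekua equation for [W = p^(1/2) u + k p^(-1/2) v] and removing the
    logarithmic derivatives of [f = p^(1/2) u0] shows that it is equivalent to
    the first order system ([vekua_conjugate])

      [(u0 v)_x = - a U_y,   (u0 v)_y = a U_x].

    Given [u], this prescribes the gradient of [u0 v]; given [v], it prescribes
    the gradient of [- U]. In both cases the prescribed gradient is closed
    because the given function solves its second order equation: the latter is
    [div (a grad U) = 0] for [u], and [div ((1 / a) grad (u0 v)) = 0] for [v].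
    Both facts are the same factorisation [solution_quotient], the second being
    its instance for the dual equation and its solution [1 / u0]
    ([inverse_solution]). Conversely a function whose gradient is prescribed by
    the system solves the other second order equation, by the symmetry of second
    derivatives ([conjugate_solves]).

    It remains to identify the functions with gradient [2 (Phi_1, Phi_2)] with
    the family A-bar[Phi] ([Abar_gradient]); uniqueness up to a constant is then
    uniqueness of primitives. Three facts are needed. A closed form of class C^1
    on a simply connected domain has a primitive ([closed_form_primitive]): its
    integrals along corner paths form a cocycle that is additive in small
    squares, and sums of this cocycle along fine samples of a continuous curve
    are invariant under homotopy ([chain_sum_loop]). The Riemann-Stieltjes
    integral of a gradient along a rectifiable curve is the difference of the
    end values of the primitive ([line_integral_gradient]). Any two points of
    the domain are joined by a rectifiable curve ([rectifiably_connected]), so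
    that the defining property of A-bar constrains the values everywhere. *)

Local Open Scope R_scope.

(** * Curves in the plane and the Lebesgue number of a covering by squares *)

(** The open square with centre [c] and half-side [r]: a ball of the product
    uniform structure on the plane, so that no comparison with Euclidean discs
    is ever needed. *)
Definition in_square (c : R * R) (r : R) (w : R * R) : Prop :=
  Rabs (fst w - fst c) < r /\ Rabs (snd w - snd c) < r.

Lemma in_square_center (c : R * R) (r : posreal) : in_square c r c.
Proof.
  split; rewrite Rminus_diag, Rabs_R0; apply cond_pos.
Qed.

Lemma open_in_square (Omega : R * R -> Prop) (c : R * R) :
  open Omega -> Omega c ->
  exists r : posreal, forall w, in_square c r w -> Omega w.
Proof.
  intros HO Hc. destruct (HO c Hc) as [r Hr].
  exists r. intros w Hw. apply Hr. exact Hw.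
Qed.

Lemma continuous_on_in_square (T : UniformSpace) (D : T -> Prop) (h : T -> R * R) :
  continuous_on D h <->
  forall (x : T) (e : posreal), D x ->
    exists d : posreal, forall x', D x' -> ball x d x' -> in_square (h x) e (h x').
Proof.
  split.
  - intros H x e Hx.
    destruct (H x Hx (fun w => in_square (h x) e w)) as [d Hd].
    + exists e. intros w Hw. exact Hw.
    + exists d. intros x' Hx' Hb. exact (Hd x' Hb Hx').
  - intros H x Hx P [e He].
    destruct (H x e Hx) as [d Hd]. exists d. intros x' Hb Hx'.
    apply He. exact (Hd x' Hx' Hb).
Qed.

(** Lebesgue number lemma: if every point of [Omega] is the centre of an
    admissible square, then there is a scale [d] below which the values of [H]
    stay in one admissible square. *)
Lemma lebesgue_number (Omega : R * R -> Prop) (P : R * R -> posreal -> Prop)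
    (H : R * R -> R * R) :
  continuous_on
    (fun st : R * R => unit_interval (fst st) /\ unit_interval (snd st)) H ->
  (forall s t, unit_interval s -> unit_interval t -> Omega (H (s, t))) ->
  (forall c, Omega c -> exists r, P c r) ->
  exists d : posreal, forall s t, unit_interval s -> unit_interval t ->
    exists c r, Omega c /\ P c r /\
      forall s' t', unit_interval s' -> unit_interval t' ->
        Rabs (s' - s) < d -> Rabs (t' - t) < d -> in_square c r (H (s', t')).
Proof.
  intros Hc HO HP.
  assert (Hd : forall i j : R, exists d : posreal,
    unit_interval i -> unit_interval j ->
    exists c r, Omega c /\ P c r /\
      forall s' t', unit_interval s' -> unit_interval t' ->
        Rabs (s' - i) < 2 * d -> Rabs (t' - j) < 2 * d ->
        in_square c r (H (s', t'))).
  (* The factor 2 leaves room for a further displacement by less than [d]. *)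
  { intros i j.
    destruct (classic (unit_interval i /\ unit_interval j)) as [[Hi Hj]|Hn].
    - destruct (HP _ (HO i j Hi Hj)) as [r Hr].
      destruct (proj1 (continuous_on_in_square _ _ _) Hc (i, j) r (conj Hi Hj))
        as [d Hd].
      assert (Hd2 : 0 < d / 2) by (pose proof (cond_pos d); lra).
      exists (mkposreal _ Hd2). intros _ _. exists (H (i, j)), r.
      split; [auto | split; [exact Hr |]].
      simpl. intros s' t' Hs Ht H1 H2. apply Hd; [split; assumption|].
      split; change (Rabs (s' - i) < d) || change (Rabs (t' - j) < d); lra.
    - exists (mkposreal 1 Rlt_0_1). tauto. }
  pose (delta := fun i j =>
    proj1_sig (constructive_indefinite_description _ (Hd i j))).
  assert (Hdelta : forall i j, unit_interval i -> unit_interval j ->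
    exists c r, Omega c /\ P c r /\
      forall s' t', unit_interval s' -> unit_interval t' ->
        Rabs (s' - i) < 2 * delta i j -> Rabs (t' - j) < 2 * delta i j ->
        in_square c r (H (s', t'))).
  { intros i j. unfold delta.
    destruct (constructive_indefinite_description _ (Hd i j)) as [d h]. exact h. }
  destruct (compactness_value_2d 0 1 0 1 delta) as [d Hval].
  exists d. intros s t Hs Ht.
  destruct (NNPP _ (Hval s t Hs Ht)) as (i & j & Hi & Hj & Hsi & Htj & Hle).
  destruct (Hdelta i j Hi Hj) as (c & r & Hcc & HPr & Hsq).
  exists c, r. split; [exact Hcc | split; [exact HPr |]].
  intros s' t' Hs' Ht' H1 H2. apply Hsq; trivial.
  - replace (s' - i) with ((s' - s) + (s - i)) by ring.
    pose proof (Rabs_triang (s' - s) (s - i)). lra.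
  - replace (t' - j) with ((t' - t) + (t - j)) by ring.
    pose proof (Rabs_triang (t' - t) (t - j)). lra.
Qed.

Lemma lebesgue_number_curve (Omega : R * R -> Prop)
    (P : R * R -> posreal -> Prop) (gamma : R -> R * R) :
  curve_in Omega gamma ->
  (forall c, Omega c -> exists r, P c r) ->
  exists d : posreal, forall t, unit_interval t ->
    exists c r, Omega c /\ P c r /\
      forall t', unit_interval t' -> Rabs (t' - t) < d ->
        in_square c r (gamma t').
Proof.
  intros [Hc HO] HP.
  destruct (lebesgue_number Omega P (fun st => gamma (snd st))) as [d Hd].
  - apply continuous_on_in_square. intros [s t] e [Hs Ht]. simpl in *.
    destruct (proj1 (continuous_on_in_square _ _ _) Hc t e Ht) as [d Hd].
    exists d. intros [s' t'] [Hs' Ht'] [_ Hb]. apply Hd; assumption.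
  - intros s t _ Ht. apply HO, Ht.
  - exact HP.
  - exists d. intros t Ht.
    assert (H0 : unit_interval 0) by (split; lra).
    destruct (Hd 0 t H0 Ht) as (c & r & H1 & H2 & H3).
    exists c, r. split; [exact H1 | split; [exact H2 |]].
    intros t' Ht' Hb. apply (H3 0 t'); trivial.
    rewrite Rminus_diag, Rabs_R0. apply cond_pos.
Qed.

Lemma curve_in_intro (Omega : R * R -> Prop) (gamma : R -> R * R) :
  (forall (t : R) (e : posreal), unit_interval t ->
    exists d : posreal, forall t', unit_interval t' -> Rabs (t' - t) < d ->
      in_square (gamma t) e (gamma t')) ->
  (forall t, unit_interval t -> Omega (gamma t)) -> curve_in Omega gamma.
Proof.
  intros Hc HO. split; [|exact HO].
  apply continuous_on_in_square. intros t e Ht.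
  destruct (Hc t e Ht) as [d Hd]. exists d. intros t' Ht' Hb. apply Hd; trivial.
Qed.

Lemma curve_continuity (Omega : R * R -> Prop) (gamma : R -> R * R) :
  curve_in Omega gamma ->
  forall (t : R) (e : posreal), unit_interval t ->
    exists d : posreal, forall t', unit_interval t' -> Rabs (t' - t) < d ->
      in_square (gamma t) e (gamma t').
Proof.
  intros [Hc _] t e Ht.
  destruct (proj1 (continuous_on_in_square _ _ _) Hc t e Ht) as [d Hd].
  exists d. intros t' Ht' Hb. apply Hd; trivial.
Qed.

(** [g1] followed by [g2], each run at double speed. *)
Definition concat (g1 g2 : R -> R * R) (t : R) : R * R :=
  if Rle_dec t (1 / 2) then g1 (2 * t) else g2 (2 * t - 1).

Definition reverse (g : R -> R * R) (t : R) : R * R := g (1 - t).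

Definition segment (a b : R * R) (t : R) : R * R :=
  (fst a + t * (fst b - fst a), snd a + t * (snd b - snd a)).

Lemma concat_left (g1 g2 : R -> R * R) (t : R) :
  t <= 1 / 2 -> concat g1 g2 t = g1 (2 * t).
Proof. intros H. unfold concat. destruct (Rle_dec t (1 / 2)); [easy | lra]. Qed.

Lemma concat_right (g1 g2 : R -> R * R) (t : R) :
  g1 1 = g2 0 -> 1 / 2 <= t -> concat g1 g2 t = g2 (2 * t - 1).
Proof.
  intros H Ht. unfold concat. destruct (Rle_dec t (1 / 2)); [|easy].
  replace (2 * t) with 1 by lra. rewrite H. f_equal. lra.
Qed.

Lemma curve_concat (Omega : R * R -> Prop) (g1 g2 : R -> R * R) :
  curve_in Omega g1 -> curve_in Omega g2 -> g1 1 = g2 0 ->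
  curve_in Omega (concat g1 g2).
Proof.
  intros H1 H2 Heq. apply curve_in_intro.
  - intros t e [Ht0 Ht1].
    destruct (Rle_or_lt t (1 / 2)) as [Hl|Hl].
    + destruct (curve_continuity _ _ H1 (2 * t) e) as [d1 Hd1]; [split; lra|].
      pose proof (cond_pos d1).
      destruct (Rlt_or_le t (1 / 2)) as [Hl'|Hl'].
      * assert (Hm : 0 < Rmin (d1 / 2) (1 / 2 - t)) by (apply Rmin_pos; lra).
        exists (mkposreal _ Hm). simpl. intros t' [Ht0' Ht1'] Hb.
        pose proof (Rmin_l (d1 / 2) (1 / 2 - t)).
        pose proof (Rmin_r (d1 / 2) (1 / 2 - t)).
        apply Rabs_def2 in Hb.
        rewrite !concat_left by lra. apply Hd1; [split; lra |].
        apply Rabs_def1; lra.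
      * destruct (curve_continuity _ _ H2 0 e) as [d2 Hd2]; [split; lra|].
        pose proof (cond_pos d2).
        assert (Hm : 0 < Rmin (d1 / 2) (d2 / 2)) by (apply Rmin_pos; lra).
        exists (mkposreal _ Hm). simpl. intros t' [Ht0' Ht1'] Hb.
        pose proof (Rmin_l (d1 / 2) (d2 / 2)).
        pose proof (Rmin_r (d1 / 2) (d2 / 2)).
        apply Rabs_def2 in Hb.
        assert (t = 1 / 2) by lra. subst t.
        destruct (Rle_or_lt t' (1 / 2)).
        -- rewrite !concat_left by lra. apply Hd1; [split; lra |].
           apply Rabs_def1; lra.
        -- rewrite !concat_right by (auto; lra).
           replace (2 * (1 / 2) - 1) with 0 by lra.
           apply Hd2; [split; lra |]. apply Rabs_def1; lra.
    + destruct (curve_continuity _ _ H2 (2 * t - 1) e) as [d2 Hd2]; [split; lra|].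
      pose proof (cond_pos d2).
      assert (Hm : 0 < Rmin (d2 / 2) (t - 1 / 2)) by (apply Rmin_pos; lra).
      exists (mkposreal _ Hm). simpl. intros t' [Ht0' Ht1'] Hb.
      pose proof (Rmin_l (d2 / 2) (t - 1 / 2)).
      pose proof (Rmin_r (d2 / 2) (t - 1 / 2)).
      apply Rabs_def2 in Hb.
      rewrite !concat_right by (auto; lra). apply Hd2; [split; lra |].
      apply Rabs_def1; lra.
  - intros t [Ht0 Ht1]. destruct (Rle_or_lt t (1 / 2)).
    + rewrite concat_left by lra. apply H1. split; lra.
    + rewrite concat_right by (auto; lra). apply H2. split; lra.
Qed.

Lemma curve_reverse (Omega : R * R -> Prop) (g : R -> R * R) :
  curve_in Omega g -> curve_in Omega (reverse g).
Proof.
  intros H. apply curve_in_intro.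
  - intros t e [Ht0 Ht1].
    destruct (curve_continuity _ _ H (1 - t) e) as [d Hd]; [split; lra|].
    exists d. intros t' [Ht0' Ht1'] Hb. apply Hd; [split; lra |].
    apply Rabs_def2 in Hb. apply Rabs_def1; lra.
  - intros t [Ht0 Ht1]. apply (proj2 H (1 - t)). split; lra.
Qed.

Lemma Rabs_affine_lt (x a b r t : R) :
  unit_interval t -> Rabs (a - x) < r -> Rabs (b - x) < r ->
  Rabs (a + t * (b - a) - x) < r.
Proof.
  intros [Ht0 Ht1] Ha Hb.
  replace (a + t * (b - a) - x) with ((1 - t) * (a - x) + t * (b - x)) by ring.
  apply Rle_lt_trans with (1 := Rabs_triang _ _).
  rewrite !Rabs_mult, (Rabs_pos_eq t), (Rabs_pos_eq (1 - t)) by lra.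
  destruct (Rle_or_lt (Rabs (a - x)) (Rabs (b - x))); nra.
Qed.

Lemma segment_in_square (c : R * R) (r : R) (a b : R * R) (t : R) :
  in_square c r a -> in_square c r b -> unit_interval t ->
  in_square c r (segment a b t).
Proof.
  intros [] [] Ht. split; apply Rabs_affine_lt; assumption.
Qed.

Lemma segment_0 (a b : R * R) : segment a b 0 = a.
Proof. unfold segment. rewrite !Rmult_0_l, !Rplus_0_r. now destruct a. Qed.

Lemma segment_1 (a b : R * R) : segment a b 1 = b.
Proof.
  unfold segment. destruct a, b. simpl. f_equal; ring.
Qed.

(** Lipschitz on [[0, 1]], coordinate by coordinate. *)
Definition lipschitz (L : R) (g : R -> R * R) : Prop :=
  forall s t, unit_interval s -> unit_interval t ->
    Rabs (fst (g t) - fst (g s)) <= L * Rabs (t - s) /\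
    Rabs (snd (g t) - snd (g s)) <= L * Rabs (t - s).

Lemma curve_lipschitz (Omega : R * R -> Prop) (L : R) (g : R -> R * R) :
  lipschitz L g -> (forall t, unit_interval t -> Omega (g t)) ->
  curve_in Omega g.
Proof.
  intros HL HO. apply curve_in_intro; [|exact HO].
  intros t e Ht.
  assert (Hd : 0 < e / (Rabs L + 1)).
  { apply Rdiv_lt_0_compat; [apply cond_pos|]. pose proof (Rabs_pos L). lra. }
  exists (mkposreal _ Hd). simpl. intros t' Ht' Hb.
  assert (L * Rabs (t' - t) < e).
  { pose proof (Rabs_pos L). pose proof (Rle_abs L).
    pose proof (Rabs_pos (t' - t)).
    apply Rlt_div_r in Hb; [|lra]. nra. }
  destruct (HL t t' Ht Ht'). split; lra.
Qed.

Lemma lipschitz_segment (a b : R * R) :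
  lipschitz (Rabs (fst b - fst a) + Rabs (snd b - snd a)) (segment a b).
Proof.
  intros s t _ _. simpl.
  pose proof (Rabs_pos (fst b - fst a)). pose proof (Rabs_pos (snd b - snd a)).
  pose proof (Rabs_pos (t - s)).
  split.
  - replace (fst a + t * (fst b - fst a) - (fst a + s * (fst b - fst a)))
      with ((fst b - fst a) * (t - s)) by ring.
    rewrite Rabs_mult. nra.
  - replace (snd a + t * (snd b - snd a) - (snd a + s * (snd b - snd a)))
      with ((snd b - snd a) * (t - s)) by ring.
    rewrite Rabs_mult. nra.
Qed.

Lemma Rabs_le_split (x y z L s m t : R) :
  s <= m <= t -> Rabs (y - x) <= L * (m - s) -> Rabs (z - y) <= L * (t - m) ->
  Rabs (z - x) <= L * Rabs (t - s).
Proof.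
  intros H H1 H2. rewrite (Rabs_pos_eq (t - s)) by lra.
  replace (z - x) with ((z - y) + (y - x)) by ring.
  pose proof (Rabs_triang (z - y) (y - x)). lra.
Qed.

Lemma lipschitz_concat (L1 L2 : R) (g1 g2 : R -> R * R) :
  0 <= L1 -> 0 <= L2 ->
  lipschitz L1 g1 -> lipschitz L2 g2 -> g1 1 = g2 0 ->
  lipschitz (2 * L1 + 2 * L2) (concat g1 g2).
Proof.
  intros HL1 HL2 H1 H2 Heq.
  assert (Hle : forall s t, unit_interval s -> unit_interval t -> s <= t ->
    Rabs (fst (concat g1 g2 t) - fst (concat g1 g2 s))
      <= (2 * L1 + 2 * L2) * Rabs (t - s) /\
    Rabs (snd (concat g1 g2 t) - snd (concat g1 g2 s))
      <= (2 * L1 + 2 * L2) * Rabs (t - s)).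
  { intros s t [Hs0 Hs1] [Ht0 Ht1] Hst.
    assert (Hl : forall s t, 0 <= s <= t -> t <= 1 / 2 ->
      Rabs (fst (concat g1 g2 t) - fst (concat g1 g2 s))
        <= (2 * L1 + 2 * L2) * (t - s) /\
      Rabs (snd (concat g1 g2 t) - snd (concat g1 g2 s))
        <= (2 * L1 + 2 * L2) * (t - s)).
    { clear - HL1 HL2 H1. intros s t Hs Ht. rewrite !concat_left by lra.
      destruct (H1 (2 * s) (2 * t)) as [Ha Hb]; [split; lra | split; lra |].
      rewrite (Rabs_pos_eq (2 * t - 2 * s)) in Ha, Hb by lra.
      assert (0 <= L2 * (t - s)) by (apply Rmult_le_pos; lra).
      split; lra. }
    assert (Hr : forall s t, 1 / 2 <= s <= t -> t <= 1 ->
      Rabs (fst (concat g1 g2 t) - fst (concat g1 g2 s))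
        <= (2 * L1 + 2 * L2) * (t - s) /\
      Rabs (snd (concat g1 g2 t) - snd (concat g1 g2 s))
        <= (2 * L1 + 2 * L2) * (t - s)).
    { clear - HL1 HL2 H2 Heq. intros s t Hs Ht.
      rewrite !concat_right by (auto; lra).
      destruct (H2 (2 * s - 1) (2 * t - 1)) as [Ha Hb];
        [split; lra | split; lra |].
      rewrite (Rabs_pos_eq (2 * t - 1 - (2 * s - 1))) in Ha, Hb by lra.
      assert (0 <= L1 * (t - s)) by (apply Rmult_le_pos; lra).
      split; lra. }
    destruct (Rle_or_lt t (1 / 2)) as [Ht|Ht].
    - rewrite (Rabs_pos_eq (t - s)) by lra. apply Hl; lra.
    - destruct (Rle_or_lt s (1 / 2)) as [Hs|Hs].
      + destruct (Hl s (1 / 2)) as [Ha Hb]; [lra | lra |].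
        destruct (Hr (1 / 2) t) as [Hc Hd]; [lra | lra |].
        split; eapply Rabs_le_split; try eassumption; lra.
      + rewrite (Rabs_pos_eq (t - s)) by lra. apply Hr; lra. }
  intros s t Hs Ht. destruct (Rle_or_lt s t) as [h|h].
  - apply Hle; assumption.
  - destruct (Hle t s Ht Hs) as [Ha Hb]; [lra|].
    rewrite (Rabs_minus_sym (fst _)), (Rabs_minus_sym (snd _)), (Rabs_minus_sym t s).
    split; assumption.
Qed.

(** The lengths of inscribed chords telescope; [2 * L] absorbs the passage
    from coordinates to the Euclidean norm. *)
Lemma lipschitz_rectifiable (L : R) (g : R -> R * R) :
  0 <= L -> lipschitz L g -> rectifiable g.
Proof.
  intros HL Hg. exists (2 * L). intros n t Ht.
  assert (Hmono : forall m, (m <= n)%nat ->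
    sum_n (fun i => norm (minus (g (t (S i))) (g (t i)))) m
      <= 2 * L * (t (S m) - t 0%nat)).
  { assert (Hstep : forall i, (i <= n)%nat ->
      norm (minus (g (t (S i))) (g (t i))) <= 2 * L * (t (S i) - t i)).
    { intros i Hi. destruct (Ht i Hi) as [H1 H2].
      destruct (Hg (t i) (t (S i))) as [Ha Hb]; [split; lra | split; lra |].
      rewrite (Rabs_pos_eq (t (S i) - t i)) in Ha, Hb by lra.
      change (sqrt (Rabs (fst (g (t (S i))) - fst (g (t i))) ^ 2
        + Rabs (snd (g (t (S i))) - snd (g (t i))) ^ 2)
        <= 2 * L * (t (S i) - t i)).
      set (x := Rabs (fst _ - _)) in *. set (y := Rabs (snd _ - _)) in *.
      assert (0 <= x) by apply Rabs_pos. assert (0 <= y) by apply Rabs_pos.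
      apply Rle_trans with (sqrt ((x + y) ^ 2)).
      - apply sqrt_le_1_alt. nra.
      - rewrite sqrt_pow2 by lra. lra. }
    induction m as [|m IH]; intros Hm.
    - rewrite sum_O. apply Hstep. exact Hm.
    - rewrite sum_Sn. unfold plus; simpl.
      specialize (IH ltac:(lia)). specialize (Hstep _ Hm). simpl in *. lra. }
  apply Rle_trans with (1 := Hmono n (le_n n)).
  destruct (Ht 0%nat (Nat.le_0_l n)) as [H0 _].
  destruct (Ht n (le_n n)) as [_ H1]. nra.
Qed.

(** * Primitives of local cocycles on a simply connected domain *)

(** Chasles' relation for the increments [D a b] between points of [S]. *)
Definition additive_on (S : R * R -> Prop) (D : R * R -> R * R -> R) : Prop :=
  forall a b c, S a -> S b -> S c -> D a b + D b c = D a c.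

(** Near every point of [Omega], the increments [D] come from a function;
    for a closed form, [D a b] is its integral along a corner from [a] to [b]. *)
Definition local_cocycle (Omega : R * R -> Prop) (D : R * R -> R * R -> R) :=
  forall c, Omega c -> exists r : posreal,
    (forall w, in_square c r w -> Omega w) /\ additive_on (in_square c r) D.

(** The sum of the increments of [D] along the points [z 0, ..., z n]. *)
Fixpoint chain_sum (D : R * R -> R * R -> R) (z : nat -> R * R) (n : nat) : R :=
  match n with
  | O => 0
  | S m => chain_sum D z m + D (z m) (z (S m))
  end.

(** The [j]-th point of the regular subdivision of [g] into [N] pieces. *)
Definition sample (g : R -> R * R) (N j : nat) : R * R := g (INR j / INR N).

Lemma additive_diag S D a : additive_on S D -> S a -> D a a = 0.
Proof. intros H Ha. specialize (H a a a Ha Ha Ha). lra. Qed.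

Lemma additive_swap S D a b : additive_on S D -> S a -> S b -> D b a = - D a b.
Proof.
  intros H Ha Hb. pose proof (H a b a Ha Hb Ha).
  rewrite (additive_diag S D a H Ha) in H0. lra.
Qed.

Lemma chain_sum_ext D z z' n :
  (forall j, (j <= n)%nat -> z j = z' j) -> chain_sum D z n = chain_sum D z' n.
Proof.
  induction n as [|n IH]; intros H; simpl; [reflexivity|].
  rewrite IH, (H n), (H (S n)); auto.
Qed.

Lemma chain_sum_shift D z m k :
  chain_sum D z (m + k) = chain_sum D z m + chain_sum D (fun j => z (m + j)%nat) k.
Proof.
  induction k as [|k IH]; simpl.
  - rewrite Nat.add_0_r. ring.
  - rewrite Nat.add_succ_r. simpl. rewrite IH. ring.
Qed.

Lemma chain_sum_telescope S D z n :
  additive_on S D -> (forall j, (j <= n)%nat -> S (z j)) ->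
  chain_sum D z n = D (z 0%nat) (z n).
Proof.
  intros HD. induction n as [|n IH]; intros Hz; simpl.
  - rewrite (additive_diag S D); auto.
  - rewrite IH by auto. apply HD; auto. apply Hz; lia.
Qed.

(** Two chains whose consecutive rungs lie in common additive sets have the
    same sum up to the increments along the first and the last rung. *)
Lemma chain_sum_ladder D z z' n :
  (forall j, (j < n)%nat -> exists S, additive_on S D /\
     S (z j) /\ S (z (Datatypes.S j)) /\ S (z' j) /\ S (z' (Datatypes.S j))) ->
  chain_sum D z n + D (z n) (z' n) = D (z 0%nat) (z' 0%nat) + chain_sum D z' n.
Proof.
  induction n as [|n IH]; intros Hz; simpl; [ring|].
  destruct (Hz n (le_n _)) as (S & HD & H1 & H2 & H3 & H4).
  pose proof (HD _ _ _ H1 H2 H4). pose proof (HD _ _ _ H1 H3 H4).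
  assert (IH' := IH ltac:(intros j Hj; apply Hz; lia)). lra.
Qed.

Lemma chain_sum_rev D z n :
  (forall j, (j < n)%nat -> exists S, additive_on S D /\
     S (z j) /\ S (z (Datatypes.S j))) ->
  chain_sum D (fun j => z (n - j)%nat) n = - chain_sum D z n.
Proof.
  induction n as [|n IH]; intros Hz; [simpl; ring|].
  change (chain_sum D (fun j => z (S n - j)%nat) (1 + n) = - chain_sum D z (S n)).
  rewrite chain_sum_shift.
  rewrite (chain_sum_ext D _ (fun j => z (n - j)%nat) n) by reflexivity.
  rewrite IH by (intros j Hj; apply Hz; lia).
  destruct (Hz n (le_n _)) as (S & HD & H1 & H2).
  cbn [chain_sum]. rewrite Nat.sub_0_r.
  replace (Datatypes.S n - 1)%nat with n by lia.
  rewrite (additive_swap S D _ _ HD H1 H2). ring.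
Qed.

Lemma INR_gt_0 N : (0 < N)%nat -> 0 < INR N.
Proof. intros H. apply lt_0_INR. exact H. Qed.

Lemma unit_interval_frac j N :
  (0 < N)%nat -> (j <= N)%nat -> unit_interval (INR j / INR N).
Proof.
  intros HN Hj. pose proof (INR_gt_0 N HN). pose proof (pos_INR j).
  apply le_INR in Hj. split.
  - apply Rdiv_le_0_compat; lra.
  - apply Rle_div_l; lra.
Qed.

Lemma fine_subdivision (d : posreal) :
  exists N0, (0 < N0)%nat /\ forall N, (N0 <= N)%nat -> / INR N < d.
Proof.
  destruct (archimed_cor1 d (cond_pos d)) as (N0 & H1 & H2).
  exists N0. split; [exact H2|]. intros N HN.
  apply Rle_lt_trans with (2 := H1). apply Rinv_le_contravar.
  - apply INR_gt_0, H2.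
  - apply le_INR, HN.
Qed.

Lemma frac_step j N : (0 < N)%nat -> INR (S j) / INR N - INR j / INR N = / INR N.
Proof.
  intros HN. pose proof (INR_gt_0 N HN). rewrite S_INR. field. lra.
Qed.

Lemma Rabs_0_lt (t : R) (d : posreal) : Rabs (t - t) < d.
Proof. rewrite Rminus_diag, Rabs_R0. apply cond_pos. Qed.

Lemma Rabs_step_lt (j N : nat) (d : R) :
  (0 < N)%nat -> / INR N < d -> Rabs (INR (S j) / INR N - INR j / INR N) < d.
Proof.
  intros HN Hd. rewrite frac_step by exact HN. rewrite Rabs_pos_eq; [exact Hd|].
  left. apply Rinv_0_lt_compat, INR_gt_0, HN.
Qed.

Lemma curve_uniformly_additive Omega D gamma :
  local_cocycle Omega D -> curve_in Omega gamma ->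
  exists d : posreal, forall t, unit_interval t ->
    exists S, additive_on S D /\
      forall t', unit_interval t' -> Rabs (t' - t) < d -> S (gamma t').
Proof.
  intros HD Hg.
  destruct (lebesgue_number_curve Omega
    (fun c r => additive_on (in_square c r) D) gamma Hg) as [d Hd].
  - intros c Hc. destruct (HD c Hc) as (r & _ & Hr). exists r. exact Hr.
  - exists d. intros t Ht. destruct (Hd t Ht) as (c & r & _ & Hr & Hsq).
    exists (in_square c r). split; assumption.
Qed.

(** Homotopy invariance in discrete form: on a fine grid, consecutive rows of
    the homotopy are joined by a ladder whose end rungs are trivial, and the
    last row is constant. *)
Lemma chain_sum_loop Omega D gamma :
  local_cocycle Omega D -> null_homotopic Omega gamma ->
  exists N0, (0 < N0)%nat /\
    forall N, (N0 <= N)%nat -> chain_sum D (sample gamma N) N = 0.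
Proof.
  intros HD (H & Hc & HO & H0 & H1 & Hs).
  destruct (lebesgue_number Omega (fun c r => additive_on (in_square c r) D) H)
    as [d Hd]; [exact Hc | exact HO | |].
  { intros c Hcc. destruct (HD c Hcc) as (r & _ & Hr). exists r. exact Hr. }
  destruct (fine_subdivision d) as (N0 & HN0 & Hfine).
  exists N0. split; [exact HN0|]. intros N HN.
  assert (HNp : (0 < N)%nat) by lia.
  specialize (Hfine N HN).
  assert (u0 : unit_interval 0) by (split; lra).
  assert (u1 : unit_interval 1) by (split; lra).
  assert (E0 : INR 0 / INR N = 0) by (simpl; unfold Rdiv; ring).
  assert (E1 : INR N / INR N = 1)
    by (apply Rdiv_diag; pose proof (INR_gt_0 N HNp); lra).
  pose (z := fun i j => H (INR i / INR N, INR j / INR N)).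
  assert (Hbase : D (gamma 0) (gamma 0) = 0).
  { destruct (HD (gamma 0)) as (r & _ & Hr).
    - rewrite <- (H0 0 u0). apply HO; assumption.
    - apply (additive_diag _ _ _ Hr), in_square_center. }
  assert (Hrow : forall i, (i < N)%nat ->
    chain_sum D (z i) N = chain_sum D (z (S i)) N).
  { intros i Hi.
    assert (L := chain_sum_ladder D (z i) (z (S i)) N).
    assert (Ez : forall i, (i <= N)%nat -> z i 0%nat = gamma 0 /\ z i N = gamma 0).
    { intros k Hk. unfold z. rewrite E0, E1. apply Hs, unit_interval_frac; lia. }
    destruct (Ez i) as [-> ->] in L; [lia|].
    destruct (Ez (S i)) as [-> ->] in L; [lia|].
    rewrite Hbase in L. rewrite Rplus_0_r, Rplus_0_l in L. apply L.
    intros j Hj.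
    destruct (Hd (INR i / INR N) (INR j / INR N)) as (c & r & _ & Hr & Hsq);
      try (apply unit_interval_frac; lia).
    exists (in_square c r). split; [exact Hr|].
    unfold z. repeat split; apply Hsq; try (apply unit_interval_frac; lia);
      try apply Rabs_0_lt; apply Rabs_step_lt; assumption. }
  assert (Hall : forall i, (i <= N)%nat ->
    chain_sum D (z 0%nat) N = chain_sum D (z i) N).
  { induction i as [|i IH]; intros Hi; [reflexivity|].
    rewrite IH by lia. apply Hrow. lia. }
  transitivity (chain_sum D (z 0%nat) N).
  - apply chain_sum_ext. intros j Hj. unfold z, sample. rewrite E0.
    symmetry. apply H0. apply unit_interval_frac; lia.
  - rewrite (Hall N (le_n N)).
    rewrite (chain_sum_ext D (z N) (fun _ => gamma 0)).
    + rewrite (chain_sum_telescope (fun w => w = gamma 0)); auto.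
      intros a b c -> -> ->. rewrite Hbase. ring.
    + intros j Hj. unfold z. rewrite E1. apply H1. apply unit_interval_frac; lia.
Qed.

(** Refining a fine subdivision does not change the chain sum, since each of
    its pieces stays in an additive set. *)
Lemma chain_sum_refine Omega D gamma :
  local_cocycle Omega D -> curve_in Omega gamma ->
  exists N0, (0 < N0)%nat /\ forall N M, (N0 <= N)%nat -> (0 < M)%nat ->
    chain_sum D (sample gamma (N * M)) (N * M) = chain_sum D (sample gamma N) N.
Proof.
  intros HD Hg. destruct (curve_uniformly_additive _ _ _ HD Hg) as [d Hd].
  destruct (fine_subdivision d) as (N0 & HN0 & Hfine).
  exists N0. split; [exact HN0|]. intros N M HN HM.
  assert (HNp : (0 < N)%nat) by lia.
  specialize (Hfine N HN).
  pose proof (INR_gt_0 N HNp). pose proof (INR_gt_0 M HM).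
  assert (Hblock : forall n, (n <= N)%nat ->
    chain_sum D (sample gamma (N * M)) (n * M) = chain_sum D (sample gamma N) n).
  { induction n as [|n IH]; intros Hn; [reflexivity|].
    replace (S n * M)%nat with (n * M + M)%nat by lia.
    rewrite chain_sum_shift, IH by lia. cbn [chain_sum]. f_equal.
    destruct (Hd (INR n / INR N)) as (S & HS & Hin);
      [apply unit_interval_frac; lia|].
    rewrite (chain_sum_telescope S D _ _ HS).
    - unfold sample. f_equal; f_equal.
      + rewrite Nat.add_0_r, !mult_INR. field. lra.
      + replace (n * M + M)%nat with (Datatypes.S n * M)%nat by lia.
        rewrite !mult_INR. field. lra.
    - intros j Hj. apply Hin; [apply unit_interval_frac; nia|].
      replace (INR (n * M + j) / INR (N * M) - INR n / INR N)
        with (INR j / INR M * / INR N)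
        by (rewrite plus_INR, !mult_INR; field; lra).
      destruct (unit_interval_frac j M HM Hj) as [U0 U1].
      assert (0 < / INR N) by (apply Rinv_0_lt_compat; lra).
      rewrite Rabs_pos_eq by nra. nra. }
  apply Hblock. lia.
Qed.

(** [I] is the integral of [D] along the merely continuous curve [gamma]: the
    chain sums of all fine regular subdivisions are equal to [I]. *)
Definition chain_integral (D : R * R -> R * R -> R) (gamma : R -> R * R) (I : R) :=
  exists N0, (0 < N0)%nat /\
    forall N, (N0 <= N)%nat -> chain_sum D (sample gamma N) N = I.

Lemma chain_integral_exists Omega D gamma :
  local_cocycle Omega D -> curve_in Omega gamma ->
  exists I, chain_integral D gamma I.
Proof.
  intros HD Hg. destruct (chain_sum_refine _ _ _ HD Hg) as (N0 & HN0 & H).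
  exists (chain_sum D (sample gamma N0) N0), N0. split; [exact HN0|].
  intros N HN. rewrite <- (H N N0) by lia. rewrite Nat.mul_comm.
  apply H; lia.
Qed.

Lemma chain_integral_concat Omega D g1 g2 I1 I2 :
  local_cocycle Omega D ->
  curve_in Omega g1 -> curve_in Omega g2 -> g1 1 = g2 0 ->
  chain_integral D g1 I1 -> chain_integral D g2 I2 ->
  chain_integral D (concat g1 g2) (I1 + I2).
Proof.
  intros HD Hg1 Hg2 Heq (N1 & HN1 & H1) (N2 & HN2 & H2).
  destruct (chain_integral_exists Omega D (concat g1 g2) HD)
    as (I & N3 & HN3 & H3).
  { apply curve_concat; assumption. }
  enough (I1 + I2 = I) as -> by (exists N3; split; assumption).
  set (N := (N1 + N2 + N3)%nat).
  rewrite <- (H1 N), <- (H2 N), <- (H3 (N + N)%nat) by (unfold N; lia).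
  assert (HN : 0 < INR N) by (apply INR_gt_0; unfold N; lia).
  rewrite chain_sum_shift. f_equal; apply chain_sum_ext; intros j Hj;
    apply le_INR in Hj; pose proof (pos_INR j); unfold sample.
  - rewrite concat_left; rewrite ?plus_INR.
    + f_equal. field. lra.
    + apply Rle_div_l; [lra|]. lra.
  - rewrite concat_right; rewrite ?plus_INR.
    + f_equal. field. lra.
    + exact Heq.
    + apply (Rmult_le_reg_r (INR N + INR N)); [lra|].
      unfold Rdiv at 2. rewrite Rmult_assoc, Rinv_l; lra.
Qed.

Lemma chain_integral_reverse Omega D g I :
  local_cocycle Omega D -> curve_in Omega g ->
  chain_integral D g I -> chain_integral D (reverse g) (- I).
Proof.
  intros HD Hg (N1 & HN1 & H1).
  destruct (curve_uniformly_additive _ _ _ HD Hg) as [d Hd].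
  destruct (fine_subdivision d) as (N2 & HN2 & Hfine).
  exists (N1 + N2)%nat. split; [lia|]. intros N HN.
  rewrite <- (H1 N) by lia. specialize (Hfine N ltac:(lia)).
  assert (HNp : (0 < N)%nat) by lia. pose proof (INR_gt_0 N HNp).
  rewrite <- chain_sum_rev.
  - apply chain_sum_ext. intros j Hj. unfold sample, reverse. f_equal.
    rewrite minus_INR by exact Hj. field. lra.
  - intros j Hj.
    destruct (Hd (INR j / INR N)) as (S & HS & Hin);
      [apply unit_interval_frac; lia|].
    exists S. split; [exact HS|].
    split; apply Hin; try (apply unit_interval_frac; lia).
    + apply Rabs_0_lt.
    + apply Rabs_step_lt; assumption.
Qed.

Lemma chain_integral_segment D S a b :
  additive_on S D -> (forall t, unit_interval t -> S (segment a b t)) ->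
  chain_integral D (segment a b) (D a b).
Proof.
  intros HD HS. exists 1%nat. split; [lia|]. intros N HN.
  rewrite (chain_sum_telescope S); [| exact HD |].
  - unfold sample. simpl (INR 0). unfold Rdiv. rewrite Rmult_0_l, Rinv_r.
    + now rewrite segment_0, segment_1.
    + pose proof (INR_gt_0 N HN). lra.
  - intros j Hj. apply HS, unit_interval_frac; lia.
Qed.

Lemma chain_integral_path_independent Omega D g1 g2 I1 I2 :
  simply_connected_domain Omega -> local_cocycle Omega D ->
  curve_in Omega g1 -> curve_in Omega g2 -> g1 0 = g2 0 -> g1 1 = g2 1 ->
  chain_integral D g1 I1 -> chain_integral D g2 I2 -> I1 = I2.
Proof.
  intros (_ & _ & _ & Hsc) HD Hg1 Hg2 E0 E1 H1 H2.
  assert (Hr := curve_reverse _ _ Hg2).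
  assert (Ej : g1 1 = reverse g2 0) by (unfold reverse; rewrite Rminus_0_r; auto).
  destruct (chain_integral_concat _ _ _ _ _ _ HD Hg1 Hr Ej H1
    (chain_integral_reverse _ _ _ _ HD Hg2 H2)) as (N1 & HN1 & H3).
  destruct (chain_sum_loop Omega D (concat g1 (reverse g2)) HD)
    as (N2 & HN2 & H4).
  (* The loop [g1] followed by the reverse of [g2] contracts. *)
  { apply Hsc; [apply curve_concat; assumption|].
    rewrite concat_left by lra. rewrite concat_right by (auto; lra).
    unfold reverse. rewrite Rmult_0_r, E0. f_equal. lra. }
  specialize (H3 (N1 + N2)%nat ltac:(lia)).
  specialize (H4 (N1 + N2)%nat ltac:(lia)). lra.
Qed.

(** The primitive at [b] is the integral of [D] along some curve from a base
    point to [b]; it does not depend on the curve, so near [c] it may be computed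
    by adding a segment to the curve leading to [c]. *)
Lemma cocycle_primitive Omega D :
  simply_connected_domain Omega -> local_cocycle Omega D ->
  exists F : R * R -> R, forall c, Omega c -> exists r : posreal,
    forall w, in_square c r w -> F w - F c = D c w.
Proof.
  intros Hsc HD. pose proof Hsc as (_ & (a & Ha) & Hpc & _).
  assert (HF : forall b, exists I, Omega b -> exists g,
    curve_in Omega g /\ g 0 = a /\ g 1 = b /\ chain_integral D g I).
  { intros b. destruct (classic (Omega b)) as [Hb|Hb].
    - destruct (Hpc a b Ha Hb) as (g & Hg & Eg0 & Eg1).
      destruct (chain_integral_exists _ _ _ HD Hg) as [I HI].
      exists I. intros _. exists g. auto.
    - exists 0. tauto. }
  pose (F := fun b => proj1_sig (constructive_indefinite_description _ (HF b))).
  assert (HFs : forall b, Omega b -> exists g,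
    curve_in Omega g /\ g 0 = a /\ g 1 = b /\ chain_integral D g (F b)).
  { intros b. unfold F.
    destruct (constructive_indefinite_description _ (HF b)) as [I h]. exact h. }
  exists F. intros c Hc. destruct (HD c Hc) as (r & Hr & Hadd).
  exists r. intros w Hw.
  destruct (HFs c Hc) as (g & Hg & Eg0 & Eg1 & HI).
  destruct (HFs w (Hr w Hw)) as (g' & Hg' & Eg0' & Eg1' & HI').
  assert (Hseg : forall t, unit_interval t -> in_square c r (segment c w t)).
  { intros t Ht. apply segment_in_square; auto. apply in_square_center. }
  assert (Hs : curve_in Omega (segment c w)).
  { apply (curve_lipschitz _ _ _ (lipschitz_segment c w)). intros t Ht.
    apply Hr, Hseg, Ht. }
  assert (Ej : g 1 = segment c w 0) by (rewrite segment_0; exact Eg1).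
  assert (HI2 := chain_integral_concat _ _ _ _ _ _ HD Hg Hs Ej HI
    (chain_integral_segment D _ c w Hadd Hseg)).
  enough (F w = F c + D c w) by lra.
  apply (chain_integral_path_independent Omega D g' (concat g (segment c w)));
    auto.
  - apply curve_concat; auto.
  - rewrite concat_left by lra. rewrite Rmult_0_r. congruence.
  - rewrite concat_right by (auto; lra).
    replace (2 * 1 - 1) with 1 by ring. rewrite segment_1. exact Eg1'.
Qed.

(** * Primitives of closed real one-forms *)

Lemma continuous_2d_x (f : R -> R -> R) (x y : R) :
  continuity_2d_pt f x y -> continuous (fun s => f s y) x.
Proof.
  intros H. apply filterlim_locally. intros e.
  exact (locally_2d_1d_const_y _ _ _ (H e)).
Qed.

Lemma continuous_2d_y (f : R -> R -> R) (x y : R) :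
  continuity_2d_pt f x y -> continuous (fun t => f x t) y.
Proof.
  intros H. apply filterlim_locally. intros e.
  exact (locally_2d_1d_const_x _ _ _ (H e)).
Qed.

Lemma Rabs_between (c r a b s : R) :
  Rabs (a - c) < r -> Rabs (b - c) < r -> Rmin a b <= s <= Rmax a b ->
  Rabs (s - c) < r.
Proof.
  intros Ha Hb [H1 H2]. apply Rabs_def2 in Ha. apply Rabs_def2 in Hb.
  unfold Rmin, Rmax in *. destruct (Rle_dec a b); apply Rabs_def1; lra.
Qed.

(** The integral of [P dx + Q dy] along the corner path from [z] to [w], first
    horizontal, then vertical. *)
Definition corner_integral (P Q : R -> R -> R) (z w : R * R) : R :=
  RInt (fun s => P s (snd z)) (fst z) (fst w)
  + RInt (fun t => Q (fst w) t) (snd z) (snd w).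

(** [F] has partial derivatives [P] and [Q] at every point of [S]. *)
Definition is_primitive (S : R * R -> Prop) (P Q F : R -> R -> R) : Prop :=
  forall x y, S (x, y) ->
    is_derive (fun s => F s y) x (P x y) /\
    is_derive (fun t => F x t) y (Q x y).

Lemma locally_square_x (c : R * R) (r : posreal) (x y : R) :
  in_square c r (x, y) -> locally x (fun s => in_square c r (s, y)).
Proof.
  intros [H1 H2]. simpl in *.
  assert (He : 0 < r - Rabs (x - fst c)) by lra.
  exists (mkposreal _ He). intros s Hs. split; [|exact H2]. simpl.
  assert (Hs' : Rabs (s - x) < r - Rabs (x - fst c)) by exact Hs.
  replace (s - fst c) with ((s - x) + (x - fst c)) by ring.
  pose proof (Rabs_triang (s - x) (x - fst c)). lra.
Qed.

Lemma locally_square_y (c : R * R) (r : posreal) (x y : R) :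
  in_square c r (x, y) -> locally y (fun t => in_square c r (x, t)).
Proof.
  intros [H1 H2].
  assert (H : in_square (snd c, fst c) r (y, x)) by (split; assumption).
  apply locally_square_x in H. revert H. apply filter_imp.
  intros t [h1 h2]. split; assumption.
Qed.

(** The vertical derivative is the fundamental theorem of calculus; for the
    horizontal one, differentiation under the integral sign and closedness turn
    the derivative of the vertical leg into the integral of [dP/dy]. *)
Lemma corner_integral_gradient (P Q : R -> R -> R) (c : R * R) (r : posreal) :
  (forall x y, in_square c r (x, y) -> ex_diff_n P 1 x y /\ ex_diff_n Q 1 x y /\
    Derive (fun t => P x t) y = Derive (fun s => Q s y) x) ->
  is_primitive (in_square c r) P Q (fun x y => corner_integral P Q c (x, y)).
Proof.
  intros H x y Hxy. unfold corner_integral. simpl.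
  assert (Hc := in_square_center c r). destruct c as [cx cy].
  assert (HP : forall s t, in_square (cx, cy) r (s, t) -> continuity_2d_pt P s t)
    by (intros s t Hs; apply H in Hs; apply Hs).
  assert (HQ : forall s t, in_square (cx, cy) r (s, t) -> continuity_2d_pt Q s t)
    by (intros s t Hs; apply H in Hs; apply Hs).
  assert (Hcol : forall s t, in_square (cx, cy) r (s, y) ->
    Rmin cy y <= t <= Rmax cy y -> in_square (cx, cy) r (s, t)).
  { intros s t [Hs Hy] Ht. split; [exact Hs|]. simpl in *.
    apply (Rabs_between _ _ cy y); auto. apply Hc. }
  assert (Hrow : forall s x', in_square (cx, cy) r (x', y) ->
    Rmin cx x' <= s <= Rmax cx x' -> in_square (cx, cy) r (s, cy)).
  { intros s x' Hx' Hs. split; [|apply Hc]. simpl.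
    apply (Rabs_between _ _ cx x'); auto; [apply Hc | apply Hx']. }
  assert (Hx0 : in_square (cx, cy) r (x, cy)) by (split; [apply Hxy | apply Hc]).
  simpl. split.
  - replace (P x y) with (P x cy + (P x y - P x cy)) by ring.
    apply (is_derive_plus (V := R_NormedModule)).
    + apply (is_derive_RInt (V := R_NormedModule) (fun s => P s cy) _ cx).
      * generalize (locally_square_x _ _ _ _ Hxy). apply filter_imp.
        intros x' Hx'. apply (RInt_correct (V := R_CompleteNormedModule)).
        apply (ex_RInt_continuous (V := R_CompleteNormedModule)).
        intros s Hs. apply (continuous_2d_x P), HP. apply (Hrow s x'); auto.
      * apply (continuous_2d_x P), HP, Hx0.
    + replace (P x y - P x cy) with (RInt (fun t => Derive (fun s => Q s t) x) cy y).
      * apply is_derive_RInt_param.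
        -- generalize (locally_square_x _ _ _ _ Hxy). apply filter_imp.
           intros x' Hx' t Ht.
           destruct (H x' t (Hcol _ _ Hx' Ht)) as (_ & (_ & Hex & _) & _).
           exact Hex.
        -- intros t Ht.
           destruct (H x t (Hcol _ _ Hxy Ht)) as (_ & (_ & _ & _ & Hd & _) & _).
           apply Hd.
        -- generalize (locally_square_x _ _ _ _ Hxy). apply filter_imp.
           intros x' Hx'.
           apply (ex_RInt_continuous (V := R_CompleteNormedModule)).
           intros t Ht. apply (continuous_2d_y Q), HQ, Hcol; auto.
      * apply is_RInt_unique.
        apply (is_RInt_ext (fun t => Derive (fun u => P x u) t)).
        { intros t Ht. apply H. apply Hcol; [exact Hxy | lra]. }
        apply (is_RInt_derive (V := R_CompleteNormedModule) (fun t => P x t)).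
        -- intros t Ht.
           destruct (H x t (Hcol _ _ Hxy Ht)) as ((_ & _ & Hex & _) & _).
           apply Derive_correct, Hex.
        -- intros t Ht.
           destruct (H x t (Hcol _ _ Hxy Ht)) as ((_ & _ & _ & _ & Hd) & _).
           apply (continuous_2d_y (fun u v => Derive (fun z => P u z) v)), Hd.
  - rewrite <- (Rplus_0_l (Q x y)).
    apply (is_derive_plus (V := R_NormedModule)).
    + apply (is_derive_const (V := R_NormedModule)).
    + apply (is_derive_RInt (V := R_NormedModule) (fun t => Q x t) _ cy).
      * generalize (locally_square_y _ _ _ _ Hxy). apply filter_imp.
        intros y' Hy'. apply (RInt_correct (V := R_CompleteNormedModule)).
        apply (ex_RInt_continuous (V := R_CompleteNormedModule)).
        intros t Ht. apply (continuous_2d_y Q), HQ.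
        split; [apply Hxy|]. apply (Rabs_between _ _ cy y'); auto;
          [apply Hc | apply Hy'].
      * apply (continuous_2d_y Q), HQ, Hxy.
Qed.

Lemma corner_integral_additive (P Q : R -> R -> R) (c : R * R) (r : posreal) :
  (forall x y, in_square c r (x, y) -> ex_diff_n P 1 x y /\ ex_diff_n Q 1 x y /\
    Derive (fun t => P x t) y = Derive (fun s => Q s y) x) ->
  additive_on (in_square c r) (corner_integral P Q).
Proof.
  intros H. assert (Hg := corner_integral_gradient P Q c r H).
  set (F := fun x y => corner_integral P Q c (x, y)) in Hg.
  (* In the square, [corner_integral] is the increment of one function [F]. *)
  enough (E : forall z w, in_square c r z -> in_square c r w ->
    corner_integral P Q z w = F (fst w) (snd w) - F (fst z) (snd z)).
  { intros z1 z2 z3 H1 H2 H3. rewrite !E by assumption. ring. }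
  intros [x1 y1] [x2 y2] H1 H2. simpl.
  assert (H3 : in_square c r (x2, y1)) by (split; [apply H2 | apply H1]).
  assert (Hx : forall s, Rmin x1 x2 <= s <= Rmax x1 x2 -> in_square c r (s, y1)).
  { intros s Hs. split; [|apply H1].
    apply (Rabs_between _ _ x1 x2); auto; [apply H1 | apply H2]. }
  assert (Hy : forall t, Rmin y1 y2 <= t <= Rmax y1 y2 -> in_square c r (x2, t)).
  { intros t Ht. split; [apply H2|].
    apply (Rabs_between _ _ y1 y2); auto; [apply H1 | apply H2]. }
  replace (F x2 y2 - F x1 y1) with ((F x2 y1 - F x1 y1) + (F x2 y2 - F x2 y1))
    by ring.
  unfold corner_integral at 1. simpl. f_equal; apply is_RInt_unique.
  - apply (is_RInt_derive (V := R_CompleteNormedModule) (fun s => F s y1)).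
    + intros s Hs. apply Hg, Hx, Hs.
    + intros s Hs. apply (continuous_2d_x P). apply H, Hx, Hs.
  - apply (is_RInt_derive (V := R_CompleteNormedModule) (fun t => F x2 t)).
    + intros t Ht. apply Hg, Hy, Ht.
    + intros t Ht. apply (continuous_2d_y Q). apply H, Hy, Ht.
Qed.

Lemma closed_form_primitive (Omega : R * R -> Prop) (P Q : R -> R -> R) :
  simply_connected_domain Omega ->
  (forall x y, Omega (x, y) -> ex_diff_n P 1 x y /\ ex_diff_n Q 1 x y /\
    Derive (fun t => P x t) y = Derive (fun s => Q s y) x) ->
  exists F, is_primitive Omega P Q F.
Proof.
  intros Hsc H.
  assert (Hsq : forall c, Omega c -> exists r : posreal,
    forall w, in_square c r w -> Omega w).
  { intros c Hc. apply open_in_square; [apply Hsc | exact Hc]. }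
  destruct (cocycle_primitive Omega (corner_integral P Q) Hsc) as [F HF].
  { intros c Hc. destruct (Hsq c Hc) as [r Hr]. exists r.
    split; [exact Hr|]. apply corner_integral_additive. auto. }
  exists (fun x y => F (x, y)). intros x y Hxy.
  destruct (HF _ Hxy) as [r1 Hr1]. destruct (Hsq _ Hxy) as [r2 Hr2].
  assert (Hg := corner_integral_gradient P Q (x, y) r2).
  destruct (Hg ltac:(auto) x y (in_square_center _ _)) as [Hgx Hgy].
  split.
  - apply (is_derive_ext_loc
      (fun s => F (x, y) + corner_integral P Q (x, y) (s, y))).
    + generalize (locally_square_x _ _ _ _ (in_square_center (x, y) r1)).
      apply filter_imp. intros s Hs. rewrite <- Hr1 by exact Hs.
      change (F (x, y) + (F (s, y) - F (x, y)) = F (s, y)). ring.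
    + rewrite <- (Rplus_0_l (P x y)).
      apply (is_derive_plus (V := R_NormedModule)); [|exact Hgx].
      apply (is_derive_const (V := R_NormedModule)).
  - apply (is_derive_ext_loc
      (fun t => F (x, y) + corner_integral P Q (x, y) (x, t))).
    + generalize (locally_square_y _ _ _ _ (in_square_center (x, y) r1)).
      apply filter_imp. intros t Ht. rewrite <- Hr1 by exact Ht.
      change (F (x, y) + (F (x, t) - F (x, y)) = F (x, t)). ring.
    + rewrite <- (Rplus_0_l (Q x y)).
      apply (is_derive_plus (V := R_NormedModule)); [|exact Hgy].
      apply (is_derive_const (V := R_NormedModule)).
Qed.

(** * Line integrals of gradients along rectifiable curves *)

Lemma pointed_subdiv_cons (a xi : R) (s : SF_seq) :
  pointed_subdiv (SF_cons (a, xi) s) -> a <= xi <= SF_h s /\ pointed_subdiv s.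
Proof.
  intros H. split; [|exact (ptd_cons _ _ H)].
  apply (H 0%nat). unfold SF_size. simpl. lia.
Qed.

Lemma last_SF_cons (a xi : R) (s : @SF_seq R) :
  seq.last (SF_h (SF_cons (a, xi) s)) (SF_lx (SF_cons (a, xi) s))
  = seq.last (SF_h s) (SF_lx s).
Proof. reflexivity. Qed.

Lemma seq_step_cons (a xi : R) (s : @SF_seq R) :
  seq_step (SF_lx (SF_cons (a, xi) s))
  = Rmax (Rabs (SF_h s - a)) (seq_step (SF_lx s)).
Proof. reflexivity. Qed.

Lemma pointed_subdiv_nth (s : SF_seq) (i : nat) :
  pointed_subdiv s -> (i <= SF_size s)%nat ->
  SF_h s <= seq.nth 0 (SF_lx s) i <= seq.last (SF_h s) (SF_lx s).
Proof.
  revert i. induction s as [x0 | [a xi] s IH] using SF_cons_ind; intros i H Hi.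
  - unfold SF_size in Hi. simpl in Hi. replace i with 0%nat by lia.
    simpl. lra.
  - rewrite last_SF_cons.
    destruct (pointed_subdiv_cons _ _ _ H) as [H1 H2].
    destruct i as [|i].
    + specialize (IH 0%nat H2 ltac:(lia)). simpl in *. lra.
    + assert (Hi' : (i <= SF_size s)%nat)
        by (unfold SF_size in *; simpl in Hi; lia).
      specialize (IH i H2 Hi').
      change (a <= seq.nth 0 (SF_lx s) i <= seq.last (SF_h s) (SF_lx s)). lra.
Qed.

(** The real counterpart of [line_sum]. *)
Definition real_line_sum (P Q : R -> R -> R) (gamma : R -> R * R)
    (ptd : @SF_seq R) : R :=
  seq.foldr Rplus 0
    (seq.pairmap
       (fun s t : R * R =>
          let z := gamma (snd t) in
          P (fst z) (snd z) * (fst (gamma (fst t)) - fst (gamma (fst s)))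
          + Q (fst z) (snd z) * (snd (gamma (fst t)) - snd (gamma (fst s))))
       (SF_h ptd, 0) (SF_t ptd)).

Lemma line_sum_Re_Im (P Q : R -> R -> C) (gamma : R -> R * R) (s : SF_seq) :
  Re (line_sum P Q gamma s)
    = real_line_sum (fun x y => Re (P x y)) (fun x y => Re (Q x y)) gamma s /\
  Im (line_sum P Q gamma s)
    = real_line_sum (fun x y => Im (P x y)) (fun x y => Im (Q x y)) gamma s.
Proof.
  destruct s as [h l]. unfold line_sum, real_line_sum. simpl.
  generalize (h, 0). induction l as [|[b xi] l IH]; intros a; [easy|].
  destruct (IH (b, xi)) as [IH1 IH2].
  cbn [seq.pairmap seq.foldr]. split.
  - rewrite <- IH1. simpl. unfold Re, Im. simpl. ring.
  - rewrite <- IH2. simpl. unfold Re, Im. simpl. ring.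
Qed.

Lemma real_line_sum_cons P Q gamma a xi s :
  real_line_sum P Q gamma (SF_cons (a, xi) s)
  = P (fst (gamma xi)) (snd (gamma xi))
      * (fst (gamma (SF_h s)) - fst (gamma a))
    + Q (fst (gamma xi)) (snd (gamma xi))
      * (snd (gamma (SF_h s)) - snd (gamma a))
    + real_line_sum P Q gamma s.
Proof. destruct s as [h [|b l]]; reflexivity. Qed.

(** The length of the polygon inscribed in [gamma] at the subdivision points. *)
Definition variation (gamma : R -> R * R) (s : @SF_seq R) : R :=
  seq.foldr Rplus 0
    (seq.pairmap (fun a b => norm (minus (gamma b) (gamma a)))
       (SF_h s) (seq.unzip1 (SF_t s))).

Lemma variation_cons gamma a xi s :
  variation gamma (SF_cons (a, xi) s)
  = norm (minus (gamma (SF_h s)) (gamma a)) + variation gamma s.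
Proof. reflexivity. Qed.

Lemma variation_sum_n gamma a xi s :
  variation gamma (SF_cons (a, xi) s)
  = sum_n (fun i => norm (minus
      (gamma (seq.nth 0 (SF_lx (SF_cons (a, xi) s)) (S i)))
      (gamma (seq.nth 0 (SF_lx (SF_cons (a, xi) s)) i)))) (SF_size s).
Proof.
  revert a xi. induction s as [x0 | [b eta] s IH] using SF_cons_ind; intros a xi.
  - unfold SF_size. simpl. rewrite sum_O. unfold variation. simpl. apply Rplus_0_r.
  - rewrite variation_cons, IH.
    replace (SF_size (SF_cons (b, eta) s)) with (S (SF_size s)) by reflexivity.
    unfold sum_n at 2. rewrite sum_Sn_m by lia.
    rewrite <- sum_n_m_S. reflexivity.
Qed.

Lemma variation_bounded (gamma : R -> R * R) :
  rectifiable gamma -> exists L, 0 <= L /\ forall s : SF_seq,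
    pointed_subdiv s -> 0 <= SF_h s -> seq.last (SF_h s) (SF_lx s) <= 1 ->
    variation gamma s <= L.
Proof.
  intros [L HL]. exists (Rmax 0 L). split; [apply Rmax_l|].
  intros s Hs H0 H1.
  destruct s as [x0 | [a xi] s _] using SF_cons_ind.
  - apply Rmax_l.
  - apply Rle_trans with (2 := Rmax_r 0 L). rewrite variation_sum_n.
    apply (HL (SF_size s) (fun i => seq.nth 0 (SF_lx (SF_cons (a, xi) s)) i)).
    intros i Hi.
    assert (Hsz : SF_size (SF_cons (a, xi) s) = S (SF_size s)) by reflexivity.
    pose proof (pointed_subdiv_nth _ i Hs ltac:(lia)).
    pose proof (pointed_subdiv_nth _ (S i) Hs ltac:(lia)).
    specialize (Hs i ltac:(lia)). lra.
Qed.

Lemma norm_coordinates (a b : R * R) :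
  Rabs (fst b - fst a) <= norm (minus b a) /\
  Rabs (snd b - snd a) <= norm (minus b a).
Proof.
  destruct (norm_prod (fst b - fst a) (snd b - snd a)) as [H _].
  split; eapply Rle_trans; [| exact H | | exact H];
    [apply Rmax_l | apply Rmax_r].
Qed.

(** On a square where [P] and [Q] stay within [e] of their values at the
    centre, the increment of [F] differs from its first order approximation at
    any point [z] of the square by at most [2 * e] times the displacement. *)
Lemma primitive_increment (c : R * R) (r e : posreal) (P Q F : R -> R -> R)
    (a z b : R * R) :
  is_primitive (in_square c r) P Q F ->
  (forall w, in_square c r w ->
    Rabs (P (fst w) (snd w) - P (fst c) (snd c)) < e /\
    Rabs (Q (fst w) (snd w) - Q (fst c) (snd c)) < e) ->
  in_square c r a -> in_square c r z -> in_square c r b ->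
  Rabs (F (fst b) (snd b) - F (fst a) (snd a)
    - (P (fst z) (snd z) * (fst b - fst a) + Q (fst z) (snd z) * (snd b - snd a)))
  <= 2 * e * (Rabs (fst b - fst a) + Rabs (snd b - snd a)).
Proof.
  intros HF Hosc Ha Hz Hb.
  destruct a as [a1 a2], b as [b1 b2]. simpl.
  assert (Hx : forall s, Rmin a1 b1 <= s <= Rmax a1 b1 -> in_square c r (s, a2)).
  { intros s Hs. split; [|apply Ha].
    apply (Rabs_between _ _ a1 b1); auto; [apply Ha | apply Hb]. }
  assert (Hy : forall t, Rmin a2 b2 <= t <= Rmax a2 b2 -> in_square c r (b1, t)).
  { intros t Ht. split; [apply Hb|].
    apply (Rabs_between _ _ a2 b2); auto; [apply Ha | apply Hb]. }
  assert (Hcont : forall (g : R -> R) x l, is_derive g x l -> continuity_pt g x).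
  { intros g x l Hg. apply continuity_pt_filterlim.
    apply (ex_derive_continuous (V := R_NormedModule) g). exists l. exact Hg. }
  destruct (MVT_gen (fun s => F s a2) a1 b1 (fun s => P s a2)) as (s & Hs & Es).
  { intros s Hs. apply HF, Hx. lra. }
  { intros s Hs. apply (Hcont _ _ (P s a2)). apply HF, Hx, Hs. }
  destruct (MVT_gen (fun t => F b1 t) a2 b2 (fun t => Q b1 t)) as (t & Ht & Et).
  { intros t Ht. apply HF, Hy. lra. }
  { intros t Ht. apply (Hcont _ _ (Q b1 t)). apply HF, Hy, Ht. }
  simpl in Es, Et.
  destruct (Hosc _ (Hx s Hs)) as [HPs _]. destruct (Hosc _ (Hy t Ht)) as [_ HQt].
  destruct (Hosc _ Hz) as [HPz HQz]. simpl in HPs, HQt.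
  set (p := P (fst z) (snd z)) in *. set (q := Q (fst z) (snd z)) in *.
  set (p0 := P (fst c) (snd c)) in *. set (q0 := Q (fst c) (snd c)) in *.
  replace (F b1 b2 - F a1 a2 - (p * (b1 - a1) + q * (b2 - a2)))
    with ((P s a2 - p) * (b1 - a1) + (Q b1 t - q) * (b2 - a2)) by lra.
  apply Rle_trans with (1 := Rabs_triang _ _). rewrite !Rabs_mult.
  assert (Rabs (P s a2 - p) <= 2 * e).
  { apply Rabs_def2 in HPs. apply Rabs_def2 in HPz. apply Rabs_le. lra. }
  assert (Rabs (Q b1 t - q) <= 2 * e).
  { apply Rabs_def2 in HQt. apply Rabs_def2 in HQz. apply Rabs_le. lra. }
  pose proof (Rabs_pos (b1 - a1)). pose proof (Rabs_pos (b2 - a2)). nra.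
Qed.

(** Summation of the local estimates: each term is compared with the
    increment of [F], and these increments telescope. *)
Lemma real_line_sum_estimate (P Q F : R -> R -> R) (gamma : R -> R * R) (d e : R)
    (s : SF_seq) :
  0 <= e ->
  (forall a xi b, 0 <= a -> b <= 1 -> a <= xi <= b -> b - a < d ->
    Rabs (F (fst (gamma b)) (snd (gamma b)) - F (fst (gamma a)) (snd (gamma a))
      - (P (fst (gamma xi)) (snd (gamma xi)) * (fst (gamma b) - fst (gamma a))
         + Q (fst (gamma xi)) (snd (gamma xi)) * (snd (gamma b) - snd (gamma a))))
    <= e * (Rabs (fst (gamma b) - fst (gamma a))
            + Rabs (snd (gamma b) - snd (gamma a)))) ->
  pointed_subdiv s -> 0 <= SF_h s -> seq.last (SF_h s) (SF_lx s) <= 1 ->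
  seq_step (SF_lx s) < d ->
  let l := seq.last (SF_h s) (SF_lx s) in
  Rabs (real_line_sum P Q gamma s
    - (F (fst (gamma l)) (snd (gamma l))
       - F (fst (gamma (SF_h s))) (snd (gamma (SF_h s)))))
  <= 2 * e * variation gamma s.
Proof.
  intros He Hloc.
  induction s as [x0 | [a xi] s IH] using SF_cons_ind; intros Hs H0 H1 Hd l.
  - unfold l, real_line_sum, variation. simpl.
    rewrite Rminus_diag, Rminus_0_r, Rabs_R0. lra.
  - unfold l. clear l. rewrite last_SF_cons in *. rewrite seq_step_cons in Hd.
    destruct (pointed_subdiv_cons _ _ _ Hs) as [Hxi Hs']. simpl in H0.
    pose proof (Rmax_l (Rabs (SF_h s - a)) (seq_step (SF_lx s))).
    pose proof (Rmax_r (Rabs (SF_h s - a)) (seq_step (SF_lx s))).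
    pose proof (Rle_abs (SF_h s - a)).
    pose proof (pointed_subdiv_nth s 0 Hs' (Nat.le_0_l _)) as Hn.
    change (seq.nth 0 (SF_lx s) 0) with (SF_h s) in Hn.
    specialize (IH Hs' ltac:(lra) H1 ltac:(lra)). cbv zeta in IH.
    assert (Hl := Hloc a xi (SF_h s) H0 ltac:(lra) Hxi ltac:(lra)).
    rewrite real_line_sum_cons, variation_cons. change (SF_h (SF_cons (a, xi) s)) with a.
    destruct (norm_coordinates (gamma a) (gamma (SF_h s))) as [N1 N2].
    set (N := norm _) in *.
    set (T := P _ _ * _ + Q _ _ * _) in *.
    set (Fl := F (fst (gamma (seq.last _ _))) _) in *.
    set (Fh := F (fst (gamma (SF_h s))) _) in *.
    set (Fa := F (fst (gamma a)) _) in *.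
    replace (T + real_line_sum P Q gamma s - (Fl - Fa))
      with ((real_line_sum P Q gamma s - (Fl - Fh)) - (Fh - Fa - T)) by ring.
    apply Rle_trans with (1 := Rabs_triang _ _). rewrite Rabs_Ropp.
    assert (e * (Rabs (fst (gamma (SF_h s)) - fst (gamma a))
            + Rabs (snd (gamma (SF_h s)) - snd (gamma a))) <= e * (N + N))
      by (apply Rmult_le_compat_l; lra).
    lra.
Qed.

Lemma real_line_integral (Omega : R * R -> Prop) (P Q F : R -> R -> R)
    (gamma : R -> R * R) :
  open Omega -> is_primitive Omega P Q F ->
  (forall x y, Omega (x, y) -> continuity_2d_pt P x y /\ continuity_2d_pt Q x y) ->
  curve_in Omega gamma -> rectifiable gamma ->
  forall e : posreal, Riemann_fine 0 1 (fun s => Rabs (real_line_sum P Q gamma s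
    - (F (fst (gamma 1)) (snd (gamma 1)) - F (fst (gamma 0)) (snd (gamma 0)))) < e).
Proof.
  intros HO HF HPQ Hg Hr e.
  destruct (variation_bounded _ Hr) as (L & HL0 & HL).
  assert (He' : 0 < e / (4 * L + 4)).
  { apply Rdiv_lt_0_compat; [apply cond_pos | lra]. }
  set (e' := mkposreal _ He').
  (* [e'] makes [2 * (2 * e') * L < e], the factors 2 coming from
     [primitive_increment] and [real_line_sum_estimate]. *)
  destruct (lebesgue_number_curve Omega (fun c r =>
    (forall w, in_square c r w -> Omega w) /\
    (forall w, in_square c r w ->
      Rabs (P (fst w) (snd w) - P (fst c) (snd c)) < e' /\
      Rabs (Q (fst w) (snd w) - Q (fst c) (snd c)) < e')) gamma Hg) as [d Hd].
  { intros [x y] Hc. destruct (open_in_square Omega _ HO Hc) as [r1 Hr1].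
    destruct (HPQ x y Hc) as [HP HQ].
    destruct (HP e') as [r2 Hr2]. destruct (HQ e') as [r3 Hr3].
    assert (Hm : 0 < Rmin r1 (Rmin r2 r3))
      by (repeat apply Rmin_pos; apply cond_pos).
    pose proof (Rmin_l r1 (Rmin r2 r3)). pose proof (Rmin_r r1 (Rmin r2 r3)).
    pose proof (Rmin_l r2 r3). pose proof (Rmin_r r2 r3).
    exists (mkposreal _ Hm). split.
    - intros w [h1 h2]. simpl in *. apply Hr1. split; simpl; lra.
    - intros w [h1 h2]. simpl in *. split; [apply Hr2 | apply Hr3]; lra. }
  exists d. intros s Hstep (Hpt & Hh & Hlast).
  rewrite Rmin_left in Hh by lra. rewrite Rmax_right in Hlast by lra.
  apply Rle_lt_trans with (2 * (2 * e') * variation gamma s).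
  - assert (Hest := real_line_sum_estimate P Q F gamma d (2 * e') s).
    rewrite Hlast, Hh in Hest. apply Hest; clear Hest; trivial; try lra.
    { pose proof (cond_pos e'). lra. }
    intros a xi b Ha Hb Hxi Hab.
    assert (Uxi : unit_interval xi) by (split; lra).
    destruct (Hd xi Uxi) as (c & r & Hc & (Hin & Hosc) & Hsq).
    apply (primitive_increment c r e'); auto.
    + intros x y Hxy. apply HF, Hin, Hxy.
    + apply Hsq; [split; lra|]. apply Rabs_def1; lra.
    + apply Hsq; [exact Uxi|]. apply Rabs_0_lt.
    + apply Hsq; [split; lra|]. apply Rabs_def1; lra.
  - assert (Hv := HL s Hpt ltac:(lra) ltac:(lra)).
    pose proof (cond_pos e').
    apply Rle_lt_trans with (4 * e' * L); [nra|].
    assert (E : e' * (4 * L + 4) = e) by (simpl; field; lra). nra.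
Qed.

(** * Calculus of complex valued functions of two real variables *)

(** Derivative of a complex valued function of a real variable, by real and
    imaginary parts. *)
Definition is_cderive (h : R -> C) (t : R) (l : C) : Prop :=
  is_derive (fun s => Re (h s)) t (Re l) /\
  is_derive (fun s => Im (h s)) t (Im l).

Lemma is_cderive_ext_loc (g h : R -> C) (t : R) (l : C) :
  locally t (fun s => g s = h s) -> is_cderive g t l -> is_cderive h t l.
Proof.
  intros H [H1 H2]. split.
  - apply (is_derive_ext_loc (fun s => Re (g s))); [|exact H1].
    revert H. apply filter_imp. intros s ->. reflexivity.
  - apply (is_derive_ext_loc (fun s => Im (g s))); [|exact H2].
    revert H. apply filter_imp. intros s ->. reflexivity.
Qed.

Lemma is_cderive_const (c : C) (t : R) : is_cderive (fun _ => c) t 0.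
Proof. split; apply (is_derive_const (V := R_NormedModule)). Qed.

Lemma is_cderive_plus (g h : R -> C) (t : R) (l m : C) :
  is_cderive g t l -> is_cderive h t m ->
  is_cderive (fun s => g s + h s)%C t (l + m)%C.
Proof.
  intros [H1 H2] [H3 H4].
  split; apply (is_derive_plus (V := R_NormedModule)); assumption.
Qed.

Lemma is_cderive_opp (g : R -> C) (t : R) (l : C) :
  is_cderive g t l -> is_cderive (fun s => - g s)%C t (- l)%C.
Proof.
  intros [H1 H2].
  split; apply (is_derive_opp (V := R_NormedModule)); assumption.
Qed.

Lemma is_cderive_mult (g h : R -> C) (t : R) (l m : C) :
  is_cderive g t l -> is_cderive h t m ->
  is_cderive (fun s => g s * h s)%C t (l * h t + g t * m)%C.
Proof.
  intros [H1 H2] [H3 H4]. unfold is_cderive.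
  assert (Hr : forall g1 h1 g2 h2 : R -> R, forall l1 m1 l2 m2 k : R,
    is_derive g1 t l1 -> is_derive h1 t m1 ->
    is_derive g2 t l2 -> is_derive h2 t m2 ->
    is_derive (fun s => g1 s * h1 s + k * (g2 s * h2 s)) t
      (l1 * h1 t + g1 t * m1 + k * (l2 * h2 t + g2 t * m2))).
  { intros g1 h1 g2 h2 l1 m1 l2 m2 k G1 G2 G3 G4. auto_derive.
    - repeat split; eexists; eassumption.
    - apply is_derive_unique in G1, G2, G3, G4.
      rewrite (G1 : Derive (fun x : R => g1 x) t = l1),
        (G2 : Derive (fun x : R => h1 x) t = m1),
        (G3 : Derive (fun x : R => g2 x) t = l2),
        (G4 : Derive (fun x : R => h2 x) t = m2).
      ring. }
  split.
  - assert (G := Hr _ _ _ _ _ _ _ _ (-1) H1 H3 H2 H4).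
    eapply is_derive_ext; [| match type of G with is_derive _ _ ?v =>
      replace (Re _) with v; [exact G|] end].
    + intros s. simpl. unfold Re, Im. simpl. ring.
    + unfold Re, Im. simpl. ring.
  - assert (G := Hr _ _ _ _ _ _ _ _ 1 H1 H4 H2 H3).
    eapply is_derive_ext; [| match type of G with is_derive _ _ ?v =>
      replace (Im _) with v; [exact G|] end].
    + intros s. simpl. unfold Re, Im. simpl. ring.
    + unfold Re, Im. simpl. ring.
Qed.

Lemma C_norm2_neq_0 (z : C) : z <> 0%C -> fst z ^ 2 + snd z ^ 2 <> 0.
Proof.
  intros H E. apply H. destruct z as [a b]. simpl in E.
  assert (a = 0) by nra. assert (b = 0) by nra. subst. reflexivity.
Qed.

Lemma is_cderive_inv (g : R -> C) (t : R) (l : C) :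
  g t <> 0%C -> is_cderive g t l ->
  is_cderive (fun s => / g s)%C t (- l * (/ g t * / g t))%C.
Proof.
  intros Hg [H1 H2]. assert (Hn := C_norm2_neq_0 _ Hg).
  assert (Hr : forall g1 g2 k : R -> R, forall l1 l2 m : R,
    is_derive g1 t l1 -> is_derive g2 t l2 -> is_derive k t m ->
    g1 t ^ 2 + g2 t ^ 2 <> 0 ->
    is_derive (fun s => k s / (g1 s ^ 2 + g2 s ^ 2)) t
      (m / (g1 t ^ 2 + g2 t ^ 2)
       - k t * (2 * g1 t * l1 + 2 * g2 t * l2) / (g1 t ^ 2 + g2 t ^ 2) ^ 2)).
  { intros g1 g2 k l1 l2 m G1 G2 G3 Hk. auto_derive.
    - repeat split; try (eexists; eassumption). simpl in Hk |- *. exact Hk.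
    - apply is_derive_unique in G1, G2, G3.
      rewrite (G1 : Derive (fun x : R => g1 x) t = l1),
        (G2 : Derive (fun x : R => g2 x) t = l2),
        (G3 : Derive (fun x : R => k x) t = m).
      field. simpl in Hk |- *. exact Hk. }
  split.
  - assert (G := Hr _ _ _ _ _ _ H1 H2 H1 Hn).
    eapply is_derive_ext; [| match type of G with is_derive _ _ ?v =>
      replace (Re _) with v; [exact G|] end].
    + intros s. reflexivity.
    + unfold Re, Im. simpl. field. contradict Hn. simpl. lra.
  - assert (H3 : is_derive (fun s => - Im (g s)) t (- Im l))
      by (apply (is_derive_opp (V := R_NormedModule)); exact H2).
    assert (G := Hr _ _ _ _ _ _ H1 H2 H3 Hn).
    eapply is_derive_ext; [| match type of G with is_derive _ _ ?v =>
      replace (Im _) with v; [exact G|] end].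
    + intros s. reflexivity.
    + unfold Re, Im. simpl. field. contradict Hn. simpl. lra.
Qed.

Definition is_dx (g : R -> R -> C) (x y : R) (l : C) : Prop :=
  is_cderive (fun s => g s y) x l.

Definition is_dy (g : R -> R -> C) (x y : R) (l : C) : Prop :=
  is_cderive (fun t => g x t) y l.

Lemma is_dx_Dx g x y l : is_dx g x y l -> Dx g x y = l.
Proof.
  intros [H1 H2].
  apply injective_projections; simpl; apply is_derive_unique; assumption.
Qed.

Lemma is_dy_Dy g x y l : is_dy g x y l -> Dy g x y = l.
Proof.
  intros [H1 H2].
  apply injective_projections; simpl; apply is_derive_unique; assumption.
Qed.

Lemma open_locally_x (Omega : R * R -> Prop) (x y : R) :
  open Omega -> Omega (x, y) -> locally x (fun s => Omega (s, y)).
Proof.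
  intros HO H. destruct (open_in_square _ _ HO H) as [r Hr].
  generalize (locally_square_x _ r x y (in_square_center _ _)).
  apply filter_imp. intros s Hs. apply Hr, Hs.
Qed.

Lemma open_locally_y (Omega : R * R -> Prop) (x y : R) :
  open Omega -> Omega (x, y) -> locally y (fun t => Omega (x, t)).
Proof.
  intros HO H. destruct (open_in_square _ _ HO H) as [r Hr].
  generalize (locally_square_y _ r x y (in_square_center _ _)).
  apply filter_imp. intros t Ht. apply Hr, Ht.
Qed.

Lemma open_locally_2d (Omega : R * R -> Prop) (x y : R) :
  open Omega -> Omega (x, y) -> locally_2d (fun u v => Omega (u, v)) x y.
Proof.
  intros HO H. destruct (open_in_square _ _ HO H) as [r Hr].
  exists r. intros u v Hu Hv. apply Hr. split; assumption.
Qed.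

Lemma is_dx_ext (Omega : R * R -> Prop) g h x y l :
  open Omega -> (forall a b, Omega (a, b) -> g a b = h a b) ->
  Omega (x, y) -> is_dx g x y l -> is_dx h x y l.
Proof.
  intros HO He H. apply is_cderive_ext_loc.
  generalize (open_locally_x _ _ _ HO H). apply filter_imp.
  intros s Hs. apply He, Hs.
Qed.

Lemma is_dy_ext (Omega : R * R -> Prop) g h x y l :
  open Omega -> (forall a b, Omega (a, b) -> g a b = h a b) ->
  Omega (x, y) -> is_dy g x y l -> is_dy h x y l.
Proof.
  intros HO He H. apply is_cderive_ext_loc.
  generalize (open_locally_y _ _ _ HO H). apply filter_imp.
  intros t Ht. apply He, Ht.
Qed.

Lemma C_diff_ext n (Omega : R * R -> Prop) g h :
  open Omega -> (forall a b, Omega (a, b) -> g a b = h a b) ->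
  C_diff n Omega g -> C_diff n Omega h.
Proof.
  intros HO He H x y Hxy. destruct (H x y Hxy) as [H1 H2].
  assert (L := open_locally_2d _ _ _ HO Hxy).
  split;
    [apply ex_diff_n_ext_loc with (2 := H1)
    | apply ex_diff_n_ext_loc with (2 := H2)];
    revert L; apply locally_2d_impl; apply locally_2d_forall;
    intros u v Huv; rewrite (He u v Huv); reflexivity.
Qed.

Lemma C_diff_le n m Omega g : (m <= n)%nat -> C_diff n Omega g -> C_diff m Omega g.
Proof.
  intros Hm H x y Hxy. destruct (H x y Hxy) as [H1 H2].
  split; eapply ex_diff_n_m; eassumption.
Qed.

Lemma C_diff_S n Omega g :
  C_diff (S n) Omega g ->
  (forall x y, Omega (x, y) ->
    is_dx g x y (Dx g x y) /\ is_dy g x y (Dy g x y)) /\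
  C_diff n Omega (Dx g) /\ C_diff n Omega (Dy g).
Proof.
  intros H. split; [|split].
  - intros x y Hxy.
    destruct (H x y Hxy) as [(_ & H1 & H2 & _) (_ & H3 & H4 & _)].
    split; split; apply Derive_correct; assumption.
  - intros x y Hxy.
    destruct (H x y Hxy) as [(_ & _ & _ & H1 & _) (_ & _ & _ & H2 & _)].
    split; assumption.
  - intros x y Hxy.
    destruct (H x y Hxy) as [(_ & _ & _ & _ & H1) (_ & _ & _ & _ & H2)].
    split; assumption.
Qed.

(** Class C^(n+1) from continuity and from partial derivatives that are known
    explicitly on [Omega]. *)
Lemma C_diff_intro n (Omega : R * R -> Prop) g gx gy :
  open Omega -> C_diff 0 Omega g ->
  (forall x y, Omega (x, y) -> is_dx g x y (gx x y) /\ is_dy g x y (gy x y)) ->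
  C_diff n Omega gx -> C_diff n Omega gy -> C_diff (S n) Omega g.
Proof.
  intros HO H0 Hd Hx Hy.
  assert (Hx' : C_diff n Omega (Dx g)).
  { apply (C_diff_ext n Omega gx); trivial. intros a b Hab. symmetry.
    apply is_dx_Dx, Hd, Hab. }
  assert (Hy' : C_diff n Omega (Dy g)).
  { apply (C_diff_ext n Omega gy); trivial. intros a b Hab. symmetry.
    apply is_dy_Dy, Hd, Hab. }
  intros x y Hxy. destruct (Hd x y Hxy) as [[h1 h2] [h3 h4]].
  destruct (H0 x y Hxy) as [[c1 _] [c2 _]].
  split; (split; [assumption |]; split; [eexists; eassumption |];
    split; [eexists; eassumption |]);
    split; (apply (Hx' x y Hxy) || apply (Hy' x y Hxy)).
Qed.

Lemma C_diff_const n (Omega : R * R -> Prop) (c : C) :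
  open Omega -> C_diff n Omega (fun _ _ => c).
Proof.
  intros HO. revert c. induction n as [|n IH]; intros c.
  - intros x y _. split; (split; [apply continuity_2d_pt_const | exact I]).
  - apply (C_diff_intro n Omega _ (fun _ _ => 0%C) (fun _ _ => 0%C));
      trivial.
    + intros x y _. split; (split; [apply continuity_2d_pt_const | exact I]).
    + intros x y _. split; apply is_cderive_const.
Qed.

Lemma C_diff_plus n (Omega : R * R -> Prop) g h :
  open Omega -> C_diff n Omega g -> C_diff n Omega h ->
  C_diff n Omega (fun x y => g x y + h x y)%C.
Proof.
  intros HO. revert g h. induction n as [|n IH]; intros g h Hg Hh.
  - intros x y Hxy.
    destruct (Hg x y Hxy) as [[a1 _] [a2 _]].
    destruct (Hh x y Hxy) as [[b1 _] [b2 _]].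
    split; (split; [|exact I]).
    + exact (continuity_2d_pt_plus _ _ _ _ a1 b1).
    + exact (continuity_2d_pt_plus _ _ _ _ a2 b2).
  - destruct (C_diff_S _ _ _ Hg) as (dg & gx & gy).
    destruct (C_diff_S _ _ _ Hh) as (dh & hx & hy).
    apply (C_diff_intro n Omega _ (fun x y => Dx g x y + Dx h x y)%C
      (fun x y => Dy g x y + Dy h x y)%C); auto.
    + apply (C_diff_le n); [lia|].
      apply IH; [apply (C_diff_le (S n)) | apply (C_diff_le (S n))]; auto.
    + intros x y Hxy. destruct (dg x y Hxy), (dh x y Hxy).
      split; apply is_cderive_plus; assumption.
Qed.

Lemma C_diff_mult n (Omega : R * R -> Prop) g h :
  open Omega -> C_diff n Omega g -> C_diff n Omega h ->
  C_diff n Omega (fun x y => g x y * h x y)%C.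
Proof.
  intros HO. revert g h. induction n as [|n IH]; intros g h Hg Hh.
  - intros x y Hxy.
    destruct (Hg x y Hxy) as [[a1 _] [a2 _]].
    destruct (Hh x y Hxy) as [[b1 _] [b2 _]].
    split; (split; [|exact I]).
    + exact (continuity_2d_pt_minus _ _ _ _
        (continuity_2d_pt_mult _ _ _ _ a1 b1) (continuity_2d_pt_mult _ _ _ _ a2 b2)).
    + exact (continuity_2d_pt_plus _ _ _ _
        (continuity_2d_pt_mult _ _ _ _ a1 b2) (continuity_2d_pt_mult _ _ _ _ a2 b1)).
  - destruct (C_diff_S _ _ _ Hg) as (dg & gx & gy).
    destruct (C_diff_S _ _ _ Hh) as (dh & hx & hy).
    assert (Hg' : C_diff n Omega g) by (apply (C_diff_le (S n)); auto).
    assert (Hh' : C_diff n Omega h) by (apply (C_diff_le (S n)); auto).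
    apply (C_diff_intro n Omega _ (fun x y => Dx g x y * h x y + g x y * Dx h x y)%C
      (fun x y => Dy g x y * h x y + g x y * Dy h x y)%C); auto.
    + apply (C_diff_le n); [lia|]. auto.
    + intros x y Hxy. destruct (dg x y Hxy), (dh x y Hxy).
      split; apply (is_cderive_mult (fun s => _) (fun s => _)); assumption.
    + apply C_diff_plus; auto.
    + apply C_diff_plus; auto.
Qed.

Lemma C_diff_opp n (Omega : R * R -> Prop) g :
  open Omega -> C_diff n Omega g -> C_diff n Omega (fun x y => - g x y)%C.
Proof.
  intros HO Hg.
  apply (C_diff_ext n Omega (fun x y => RtoC (-1) * g x y)%C); auto.
  - intros a b _. ring.
  - apply C_diff_mult; auto. apply C_diff_const, HO.
Qed.

Lemma C_diff_inv n (Omega : R * R -> Prop) (g : R -> R -> C) :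
  open Omega -> (forall x y, Omega (x, y) -> g x y <> 0%C) ->
  C_diff n Omega g -> C_diff n Omega (fun x y => / g x y)%C.
Proof.
  intros HO Hnz. induction n as [|n IH]; intros Hg.
  - intros x y Hxy. destruct (Hg x y Hxy) as [[a1 _] [a2 _]].
    assert (Hn : continuity_2d_pt (fun u v => / (Re (g u v) ^ 2 + Im (g u v) ^ 2)) x y).
    { apply continuity_2d_pt_inv.
      - apply continuity_2d_pt_plus; simpl; repeat apply continuity_2d_pt_mult;
          auto; apply continuity_2d_pt_const.
      - apply C_norm2_neq_0, Hnz, Hxy. }
    split; (split; [|exact I]).
    + exact (continuity_2d_pt_mult _ _ _ _ a1 Hn).
    + exact (continuity_2d_pt_mult _ _ _ _ (continuity_2d_pt_opp _ _ _ a2) Hn).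
  - destruct (C_diff_S _ _ _ Hg) as (dg & gx & gy).
    assert (Hi : C_diff n Omega (fun x y => / g x y)%C)
      by (apply IH; apply (C_diff_le (S n)); auto).
    apply (C_diff_intro n Omega _
      (fun x y => - Dx g x y * (/ g x y * / g x y))%C
      (fun x y => - Dy g x y * (/ g x y * / g x y))%C); auto.
    + apply (C_diff_le n); [lia | exact Hi].
    + intros x y Hxy. destruct (dg x y Hxy).
      split; apply (is_cderive_inv (fun s => _)); auto.
    + repeat apply C_diff_mult; auto. apply C_diff_opp; auto.
    + repeat apply C_diff_mult; auto. apply C_diff_opp; auto.
Qed.

Lemma Dx_Dy_comm (Omega : R * R -> Prop) g x y :
  open Omega -> C_diff 2 Omega g -> Omega (x, y) ->
  Dx (Dy g) x y = Dy (Dx g) x y.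
Proof.
  intros HO Hg Hxy.
  assert (L := open_locally_2d _ _ _ HO Hxy).
  destruct (Hg x y Hxy) as [H1 H2].
  assert (Hs : forall f : R -> R -> R,
    (forall u v, Omega (u, v) -> ex_diff_n f 2 u v) ->
    Derive (fun z => Derive (fun t => f z t) y) x
    = Derive (fun z => Derive (fun t => f t z) x) y).
  { intros f Hf. apply Schwarz.
    - revert L. apply locally_2d_impl, locally_2d_forall. intros u v Huv.
      destruct (Hf u v Huv) as (_ & e1 & e2 & (_ & _ & e3 & _) & (_ & e4 & _)).
      auto.
    - destruct (Hf x y Hxy) as (_ & _ & _ & _ & (_ & _ & _ & [e _] & _)). exact e.
    - destruct (Hf x y Hxy) as (_ & _ & _ & (_ & _ & _ & _ & [e _]) & _). exact e. }
  apply injective_projections.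
  - apply (Hs (fun a b => Re (g a b))). intros u v Huv. apply Hg, Huv.
  - apply (Hs (fun a b => Im (g a b))). intros u v Huv. apply Hg, Huv.
Qed.

(** * Gradients, line integrals and the family A-bar *)

(** The complex counterpart of [is_primitive]. *)
Definition has_gradient (Omega : R * R -> Prop) (P Q F : R -> R -> C) : Prop :=
  forall x y, Omega (x, y) -> is_dx F x y (P x y) /\ is_dy F x y (Q x y).

Lemma has_gradient_Re Omega P Q F :
  has_gradient Omega P Q F ->
  is_primitive Omega (fun x y => Re (P x y)) (fun x y => Re (Q x y))
    (fun x y => Re (F x y)).
Proof. intros H x y Hxy. destruct (H x y Hxy) as [[] []]. split; assumption. Qed.

Lemma has_gradient_Im Omega P Q F :
  has_gradient Omega P Q F ->
  is_primitive Omega (fun x y => Im (P x y)) (fun x y => Im (Q x y))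
    (fun x y => Im (F x y)).
Proof. intros H x y Hxy. destruct (H x y Hxy) as [[] []]. split; assumption. Qed.

Lemma has_gradient_ext (Omega : R * R -> Prop) P Q F P' Q' F' :
  open Omega ->
  (forall x y, Omega (x, y) -> P x y = P' x y) ->
  (forall x y, Omega (x, y) -> Q x y = Q' x y) ->
  (forall x y, Omega (x, y) -> F x y = F' x y) ->
  has_gradient Omega P Q F -> has_gradient Omega P' Q' F'.
Proof.
  intros HO HP HQ HF H x y Hxy. destruct (H x y Hxy) as [Hx Hy].
  rewrite <- HP, <- HQ by exact Hxy. split.
  - apply (is_dx_ext Omega F); assumption.
  - apply (is_dy_ext Omega F); assumption.
Qed.

Lemma has_gradient_scale Omega (k : C) P Q F :
  has_gradient Omega P Q F ->
  has_gradient Omega (fun x y => k * P x y)%C (fun x y => k * Q x y)%C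
    (fun x y => k * F x y)%C.
Proof.
  intros H x y Hxy. destruct (H x y Hxy) as [Hx Hy].
  split.
  - replace (k * P x y)%C with (0 * F x y + k * P x y)%C by ring.
    apply (is_cderive_mult (fun _ => k) (fun s => F s y)); [|exact Hx].
    apply is_cderive_const.
  - replace (k * Q x y)%C with (0 * F x y + k * Q x y)%C by ring.
    apply (is_cderive_mult (fun _ => k) (fun t => F x t)); [|exact Hy].
    apply is_cderive_const.
Qed.

Lemma has_gradient_add_const Omega (c : C) P Q F :
  has_gradient Omega P Q F -> has_gradient Omega P Q (fun x y => F x y + c)%C.
Proof.
  intros H x y Hxy. destruct (H x y Hxy) as [Hx Hy]. split.
  - rewrite <- (Cplus_0_r (P x y)).
    apply is_cderive_plus; [exact Hx | apply is_cderive_const].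
  - rewrite <- (Cplus_0_r (Q x y)).
    apply is_cderive_plus; [exact Hy | apply is_cderive_const].
Qed.

Lemma is_primitive_continuous (Omega : R * R -> Prop) (P Q F : R -> R -> R) x y :
  open Omega -> is_primitive Omega P Q F ->
  continuity_2d_pt P x y -> continuity_2d_pt Q x y ->
  Omega (x, y) -> continuity_2d_pt F x y.
Proof.
  intros HO HF HP HQ Hxy e.
  destruct (open_in_square _ _ HO Hxy) as [r1 Hr1].
  destruct (HP (mkposreal 1 Rlt_0_1)) as [r2 Hr2].
  destruct (HQ (mkposreal 1 Rlt_0_1)) as [r3 Hr3]. simpl in Hr2, Hr3.
  assert (Hm : 0 < Rmin r1 (Rmin r2 r3))
    by (repeat apply Rmin_pos; apply cond_pos).
  pose proof (Rmin_l r1 (Rmin r2 r3)). pose proof (Rmin_r r1 (Rmin r2 r3)).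
  pose proof (Rmin_l r2 r3). pose proof (Rmin_r r2 r3).
  set (r := mkposreal _ Hm).
  (* [2 * K + 1] exceeds the slope given by [primitive_increment] with
     [e = 1], the displacement being at most [d] in each coordinate. *)
  set (K := 2 + Rabs (P x y) + Rabs (Q x y)).
  assert (HK : 0 < 2 * K + 1).
  { unfold K. pose proof (Rabs_pos (P x y)). pose proof (Rabs_pos (Q x y)). lra. }
  assert (Hd : 0 < Rmin r (e / (2 * K + 1))).
  { apply Rmin_pos; [apply cond_pos|]. apply Rdiv_lt_0_compat; [apply cond_pos | lra]. }
  exists (mkposreal _ Hd). simpl. intros u v Hu Hv.
  pose proof (Rmin_l (Rmin r1 (Rmin r2 r3)) (e / (2 * K + 1))).
  pose proof (Rmin_r (Rmin r1 (Rmin r2 r3)) (e / (2 * K + 1))).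
  assert (Hw : in_square (x, y) r (u, v)) by (split; simpl; lra).
  assert (Hi := primitive_increment (x, y) r (mkposreal 1 Rlt_0_1) P Q F
    (x, y) (x, y) (u, v)). simpl in Hi.
  specialize (Hi ltac:(intros s t [h1 h2]; simpl in *; apply HF, Hr1;
    split; simpl; lra)).
  specialize (Hi ltac:(intros w [h1 h2]; simpl in *; split;
    [apply Hr2 | apply Hr3]; lra)).
  specialize (Hi (in_square_center _ r) (in_square_center _ r) Hw).
  set (E := F u v - F x y) in *.
  set (T := P x y * (u - x) + Q x y * (v - y)) in *.
  replace E with ((E - T) + T) by ring.
  apply Rle_lt_trans with (1 := Rabs_triang _ _).
  assert (HT : Rabs T <= Rabs (P x y) * Rabs (u - x) + Rabs (Q x y) * Rabs (v - y)).
  { unfold T. apply Rle_trans with (1 := Rabs_triang _ _). rewrite !Rabs_mult. lra. }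
  set (d := e / (2 * K + 1)) in *.
  assert (Ed : d * (2 * K + 1) = e) by (unfold d; field; lra).
  assert (0 < d) by (unfold d; apply Rdiv_lt_0_compat; [apply cond_pos | lra]).
  pose proof (Rabs_pos (P x y)). pose proof (Rabs_pos (Q x y)).
  assert (Rabs (u - x) <= d) by lra. assert (Rabs (v - y) <= d) by lra.
  pose proof (Rabs_pos (u - x)). pose proof (Rabs_pos (v - y)).
  unfold K in *. nra.
Qed.

Lemma has_gradient_C_diff n (Omega : R * R -> Prop) P Q F :
  open Omega -> has_gradient Omega P Q F ->
  C_diff n Omega P -> C_diff n Omega Q -> C_diff (S n) Omega F.
Proof.
  intros HO HF HP HQ. apply (C_diff_intro n Omega F P Q); trivial.
  apply (C_diff_le n 0) in HP; [|lia]. apply (C_diff_le n 0) in HQ; [|lia].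
  intros x y Hxy.
  destruct (HP x y Hxy) as [[a1 _] [a2 _]].
  destruct (HQ x y Hxy) as [[b1 _] [b2 _]].
  split; (split; [|exact I]).
  - apply (is_primitive_continuous Omega _ _ _ x y HO
      (has_gradient_Re _ _ _ _ HF)); assumption.
  - apply (is_primitive_continuous Omega _ _ _ x y HO
      (has_gradient_Im _ _ _ _ HF)); assumption.
Qed.

Lemma compatible_gradient Omega Phi :
  simply_connected_domain Omega -> compatible Omega Phi ->
  exists F, has_gradient Omega (fun x y => sc_part (Phi x y))
    (fun x y => vec_part (Phi x y)) F.
Proof.
  intros Hsc (H1 & H2 & Hcl).
  assert (Hcl' : forall x y, Omega (x, y) ->
    Dy (fun a b => sc_part (Phi a b)) x y = Dx (fun a b => vec_part (Phi a b)) x y).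
  { intros x y Hxy. specialize (Hcl x y Hxy).
    replace (Dy _ x y) with (Dx (fun a b => vec_part (Phi a b)) x y
      + (Dy (fun a b => sc_part (Phi a b)) x y
         - Dx (fun a b => vec_part (Phi a b)) x y))%C by ring.
    rewrite Hcl. ring. }
  destruct (closed_form_primitive Omega (fun x y => Re (sc_part (Phi x y)))
    (fun x y => Re (vec_part (Phi x y))) Hsc) as [F1 HF1].
  { intros x y Hxy. split; [apply H1, Hxy|]. split; [apply H2, Hxy|].
    exact (f_equal Re (Hcl' x y Hxy)). }
  destruct (closed_form_primitive Omega (fun x y => Im (sc_part (Phi x y)))
    (fun x y => Im (vec_part (Phi x y))) Hsc) as [F2 HF2].
  { intros x y Hxy. split; [apply H1, Hxy|]. split; [apply H2, Hxy|].
    exact (f_equal Im (Hcl' x y Hxy)). }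
  exists (fun x y => (F1 x y, F2 x y)). intros x y Hxy.
  destruct (HF1 x y Hxy), (HF2 x y Hxy). split; split; assumption.
Qed.

Lemma line_integral_gradient (Omega : R * R -> Prop) P Q F gamma :
  open Omega -> C_diff 0 Omega P -> C_diff 0 Omega Q ->
  has_gradient Omega P Q F -> curve_in Omega gamma -> rectifiable gamma ->
  is_line_integral P Q gamma
    (F (fst (gamma 1)) (snd (gamma 1)) - F (fst (gamma 0)) (snd (gamma 0)))%C.
Proof.
  intros HO HP HQ HF Hg Hr.
  assert (HRe := real_line_integral Omega _ _ _ gamma HO
    (has_gradient_Re _ _ _ _ HF)).
  assert (HIm := real_line_integral Omega _ _ _ gamma HO
    (has_gradient_Im _ _ _ _ HF)).
  apply (filterlim_locally (U := C_UniformSpace)). intros e.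
  specialize (HRe ltac:(intros x y Hxy; split;
    [apply (HP x y Hxy) | apply (HQ x y Hxy)])
    Hg Hr e).
  specialize (HIm ltac:(intros x y Hxy; split;
    [apply (HP x y Hxy) | apply (HQ x y Hxy)])
    Hg Hr e).
  generalize (filter_and _ _ HRe HIm). apply filter_imp. intros s [h1 h2].
  destruct (line_sum_Re_Im P Q gamma s) as [E1 E2].
  split.
  - change (Rabs (Re (line_sum P Q gamma s)
      - (Re (F (fst (gamma 1)) (snd (gamma 1)))
         - Re (F (fst (gamma 0)) (snd (gamma 0))))) < e).
    rewrite E1. exact h1.
  - change (Rabs (Im (line_sum P Q gamma s)
      - (Im (F (fst (gamma 1)) (snd (gamma 1)))
         - Im (F (fst (gamma 0)) (snd (gamma 0))))) < e).
    rewrite E2. exact h2.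
Qed.

Lemma line_integral_unique P Q gamma I J :
  is_line_integral P Q gamma I -> is_line_integral P Q gamma J -> I = J.
Proof.
  apply (filterlim_locally_unique (V := C_R_NormedModule) (F := Riemann_fine 0 1)).
Qed.

(** Replacing a continuous curve by a polygon through its samples at a fine
    subdivision yields a Lipschitz curve in [Omega]. *)
Lemma rectifiably_connected (Omega : R * R -> Prop) (a b : R * R) :
  open Omega -> path_connected Omega -> Omega a -> Omega b ->
  exists g, curve_in Omega g /\ rectifiable g /\ g 0 = a /\ g 1 = b.
Proof.
  intros HO Hpc Ha Hb.
  destruct (Hpc a b Ha Hb) as (gamma & Hg & E0 & E1).
  destruct (lebesgue_number_curve Omega
    (fun c r => forall w, in_square c r w -> Omega w) gamma Hg) as [d Hd].
  { intros c Hc. apply open_in_square; assumption. }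
  destruct (fine_subdivision d) as (N & HN & Hfine).
  specialize (Hfine N (le_n N)).
  assert (Hpoly : forall j, (j <= N)%nat -> exists L g, 0 <= L /\ lipschitz L g /\
    (forall t, unit_interval t -> Omega (g t)) /\
    g 0 = a /\ g 1 = sample gamma N j).
  { induction j as [|j IH]; intros Hj.
    - exists 0, (fun _ => a). split; [lra|]. split; [|split; [auto|split; [auto|]]].
      + intros s t _ _. rewrite !Rminus_diag, Rabs_R0. lra.
      + unfold sample. simpl (INR 0). unfold Rdiv. rewrite Rmult_0_l. auto.
    - destruct (IH ltac:(lia)) as (L & g & HL & Hlip & Hin & G0 & G1).
      destruct (Hd (INR j / INR N)) as (c & r & _ & Hsub & Hsq);
        [apply unit_interval_frac; lia|].
      assert (Ej : g 1 = segment (sample gamma N j) (sample gamma N (S j)) 0)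
        by (rewrite segment_0; exact G1).
      assert (Hs1 : in_square c r (sample gamma N j)).
      { apply Hsq; [apply unit_interval_frac; lia | apply Rabs_0_lt]. }
      assert (Hs2 : in_square c r (sample gamma N (S j))).
      { apply Hsq; [apply unit_interval_frac; lia | apply Rabs_step_lt; assumption]. }
      eexists _, (concat g (segment (sample gamma N j) (sample gamma N (S j)))).
      split; [|split; [apply (lipschitz_concat L); [exact HL | | exact Hlip
        | apply lipschitz_segment | exact Ej] |]].
      + pose proof (Rabs_pos (fst (sample gamma N (S j)) - fst (sample gamma N j))).
        pose proof (Rabs_pos (snd (sample gamma N (S j)) - snd (sample gamma N j))).
        lra.
      + apply Rplus_le_le_0_compat; apply Rabs_pos.
      + split; [|split].
        * intros t [Ht0 Ht1]. destruct (Rle_or_lt t (1 / 2)).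
          -- rewrite concat_left by lra. apply Hin. split; lra.
          -- rewrite concat_right by (auto; lra).
             apply Hsub, segment_in_square; auto. split; lra.
        * rewrite concat_left by lra. rewrite Rmult_0_r. exact G0.
        * rewrite concat_right by (auto; lra).
          replace (2 * 1 - 1) with 1 by ring. apply segment_1. }
  destruct (Hpoly N (le_n N)) as (L & g & HL & Hlip & Hin & G0 & G1).
  exists g. split; [|split; [|split]].
  - apply (curve_lipschitz _ L); assumption.
  - apply (lipschitz_rectifiable L); assumption.
  - exact G0.
  - rewrite G1. unfold sample. rewrite <- E1. f_equal.
    apply Rdiv_diag. pose proof (INR_gt_0 N HN). lra.
Qed.

Lemma has_gradient_unique (Omega : R * R -> Prop) P Q F G x0 y0 x y :
  open Omega -> path_connected Omega -> C_diff 0 Omega P -> C_diff 0 Omega Q ->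
  has_gradient Omega P Q F -> has_gradient Omega P Q G ->
  Omega (x0, y0) -> Omega (x, y) ->
  (F x y - F x0 y0 = G x y - G x0 y0)%C.
Proof.
  intros HO Hpc HP HQ HF HG H0 H1.
  destruct (rectifiably_connected Omega _ _ HO Hpc H0 H1) as (g & Hg & Hr & E0 & E1).
  assert (IF := line_integral_gradient Omega P Q F g HO HP HQ HF Hg Hr).
  assert (IG := line_integral_gradient Omega P Q G g HO HP HQ HG Hg Hr).
  rewrite E0, E1 in IF, IG. exact (line_integral_unique _ _ _ _ _ IF IG).
Qed.

(** For a compatible [Phi], the members of the family A-bar[Phi] are exactly the functions with
    gradient [2 Phi]. *)
Lemma Abar_gradient (Omega : R * R -> Prop) x0 y0 Phi phi :
  simply_connected_domain Omega -> Omega (x0, y0) -> compatible Omega Phi ->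
  (Abar Omega x0 y0 Phi phi <->
   has_gradient Omega (fun x y => 2 * sc_part (Phi x y))%C
     (fun x y => 2 * vec_part (Phi x y))%C phi).
Proof.
  intros Hsc H0 Hcomp. pose proof Hsc as (HO & _ & Hpc & _).
  pose proof Hcomp as (H1 & H2 & _).
  apply (C_diff_le 1 0) in H1; [|lia]. apply (C_diff_le 1 0) in H2; [|lia].
  split.
  - intros [_ [c Hc]].
    destruct (compatible_gradient Omega Phi Hsc Hcomp) as [F HF].
    apply (has_gradient_ext Omega (fun x y => 2 * sc_part (Phi x y))%C
      (fun x y => 2 * vec_part (Phi x y))%C
      (fun x y => 2 * F x y + (c - 2 * F x0 y0))%C); trivial.
    + intros x y Hxy.
      destruct (rectifiably_connected Omega _ _ HO Hpc H0 Hxy)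
        as (g & Hg & Hr & E0 & E1).
      destruct (Hc x y g Hg Hr E0 E1) as (I & HI & ->).
      assert (IF := line_integral_gradient Omega _ _ F g HO H1 H2 HF Hg Hr).
      rewrite E0, E1 in IF. rewrite (line_integral_unique _ _ _ _ _ HI IF).
      simpl. ring.
    + apply has_gradient_add_const, has_gradient_scale, HF.
  - intros Hphi. split; [exact Hcomp|]. exists (phi x0 y0).
    intros x y g Hg Hr E0 E1.
    assert (HF : has_gradient Omega (fun x y => sc_part (Phi x y))
      (fun x y => vec_part (Phi x y)) (fun x y => / 2 * phi x y)%C).
    { apply (has_gradient_scale Omega (/ 2)) in Hphi. revert Hphi.
      apply has_gradient_ext; trivial; intros a b _; field. }
    assert (IF := line_integral_gradient Omega _ _ _ g HO H1 H2 HF Hg Hr).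
    rewrite E0, E1 in IF. eexists. split; [exact IF|]. simpl. field.
Qed.

Lemma Abar_exists (Omega : R * R -> Prop) x0 y0 Phi :
  simply_connected_domain Omega -> Omega (x0, y0) -> compatible Omega Phi ->
  exists phi, Abar Omega x0 y0 Phi phi.
Proof.
  intros Hsc H0 Hcomp.
  destruct (compatible_gradient Omega Phi Hsc Hcomp) as [F HF].
  exists (fun x y => 2 * F x y)%C. apply Abar_gradient; trivial.
  apply has_gradient_scale, HF.
Qed.

(** * The conjugation system and the second order equations *)

Local Open Scope C_scope.

Lemma is_cderive_eq (h : R -> C) (t : R) (l m : C) :
  is_cderive h t l -> l = m -> is_cderive h t m.
Proof. intros H <-. exact H. Qed.

(** One-dimensional parts of [div (p grad (v w))] and of
    [div (p v^2 grad w)]; [v1] and [w1] are the first derivatives as functions,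
    [v2] and [w2] the second derivatives at [t]. *)
Lemma is_cderive_flux (p v v1 w w1 : R -> C) (t : R) (dp v2 w2 : C) :
  is_cderive p t dp -> is_cderive v t (v1 t) -> is_cderive w t (w1 t) ->
  is_cderive v1 t v2 -> is_cderive w1 t w2 ->
  is_cderive (fun s => p s * (v1 s * w s + v s * w1 s)) t
    (dp * (v1 t * w t + v t * w1 t)
     + p t * (v2 * w t + 2 * (v1 t * w1 t) + v t * w2)) /\
  is_cderive (fun s => p s * (v s * v s) * w1 s) t
    (dp * (v t * v t) * w1 t + 2 * p t * v t * v1 t * w1 t
     + p t * (v t * v t) * w2).
Proof.
  intros Hp Hv Hw Hv1 Hw1. split; eapply is_cderive_eq.
  - apply (is_cderive_mult p (fun s => v1 s * w s + v s * w1 s)); [exact Hp|].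
    apply (is_cderive_plus (fun s => v1 s * w s) (fun s => v s * w1 s));
      apply is_cderive_mult; eassumption.
  - ring.
  - apply (is_cderive_mult (fun s => p s * (v s * v s)) w1); [|exact Hw1].
    apply (is_cderive_mult p (fun s => v s * v s)); [exact Hp|].
    apply is_cderive_mult; exact Hv.
  - ring.
Qed.

Lemma Cmult_sub_eq_iff (k a b c d : C) :
  k <> 0 -> a - b = k * (c - d) -> (a = b <-> c = d).
Proof.
  intros Hk H. split; intros E.
  - assert (Ez : k * (c - d) = 0) by (rewrite <- H, E; ring).
    replace c with (/ k * (k * (c - d)) + d) by (field; exact Hk).
    rewrite Ez. ring.
  - replace a with ((a - b) + b) by ring. rewrite H, E. ring.
Qed.

(** Jacobi's factorisation: for [u = u0 U],
    [u0 (div (p grad u) + q u) = div (p u0^2 grad U)]. *)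
Lemma solution_quotient (Omega : R * R -> Prop) (p q u0 u U a : R -> R -> C) :
  open Omega -> C_diff 1 Omega p -> solution Omega p q u0 ->
  (forall x y, Omega (x, y) -> u0 x y <> 0) ->
  C_diff 2 Omega U ->
  (forall x y, Omega (x, y) -> u x y = u0 x y * U x y) ->
  (forall x y, Omega (x, y) -> a x y = p x y * u0 x y ^ 2) ->
  (solution Omega p q u <->
   forall x y, Omega (x, y) ->
     Dx (fun s t => a s t * Dx U s t) x y
     + Dy (fun s t => a s t * Dy U s t) x y = 0).
Proof.
  intros HO Hp [Hu0 Eu0] Hnz HU Hu Ha.
  destruct (C_diff_S 0 _ _ Hp) as (dp & _).
  destruct (C_diff_S 1 _ _ Hu0) as (du & Hux & Huy).
  destruct (C_diff_S 0 _ _ Hux) as (dux & _).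
  destruct (C_diff_S 0 _ _ Huy) as (duy & _).
  destruct (C_diff_S 1 _ _ HU) as (dU & HUx & HUy).
  destruct (C_diff_S 0 _ _ HUx) as (dUx & _).
  destruct (C_diff_S 0 _ _ HUy) as (dUy & _).
  assert (Hux' : forall s t, Omega (s, t) ->
    Dx u0 s t * U s t + u0 s t * Dx U s t = Dx u s t).
  { intros s t Hst. symmetry. apply is_dx_Dx.
    apply (is_dx_ext Omega (fun s t => u0 s t * U s t)); trivial.
    - intros a' b' H. symmetry. apply Hu, H.
    - destruct (du s t Hst), (dU s t Hst).
      apply (is_cderive_mult (fun s => u0 s t) (fun s => U s t)); assumption. }
  assert (Huy' : forall s t, Omega (s, t) ->
    Dy u0 s t * U s t + u0 s t * Dy U s t = Dy u s t).
  { intros s t Hst. symmetry. apply is_dy_Dy.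
    apply (is_dy_ext Omega (fun s t => u0 s t * U s t)); trivial.
    - intros a' b' H. symmetry. apply Hu, H.
    - destruct (du s t Hst), (dU s t Hst).
      apply (is_cderive_mult (fun t => u0 s t) (fun t => U s t)); assumption. }
  assert (Hid : forall x y, Omega (x, y) ->
    u0 x y * (div (fun a b => vscal (p a b) (grad u a b)) x y + q x y * u x y)
    = Dx (fun s t => a s t * Dx U s t) x y
      + Dy (fun s t => a s t * Dy U s t) x y).
  { intros x y Hxy. specialize (Eu0 x y Hxy).
    destruct (dp x y Hxy) as [px py]. destruct (du x y Hxy) as [ux uy].
    destruct (dU x y Hxy) as [Ux Uy]. destruct (dux x y Hxy) as [uxx _].
    destruct (duy x y Hxy) as [_ uyy]. destruct (dUx x y Hxy) as [Uxx _].
    destruct (dUy x y Hxy) as [_ Uyy].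
    destruct (is_cderive_flux (fun s => p s y) (fun s => u0 s y)
      (fun s => Dx u0 s y) (fun s => U s y) (fun s => Dx U s y) x _ _ _
      px ux Ux uxx Uxx) as [X1 X2].
    destruct (is_cderive_flux (fun t => p x t) (fun t => u0 x t)
      (fun t => Dy u0 x t) (fun t => U x t) (fun t => Dy U x t) y _ _ _
      py uy Uy uyy Uyy) as [Y1 Y2].
    assert (Z1 : is_dx (fun s t => p s t * Dx u0 s t) x y _)
      by (apply (is_cderive_mult (fun s => p s y) (fun s => Dx u0 s y));
          [exact px | exact uxx]).
    assert (Z2 : is_dy (fun s t => p s t * Dy u0 s t) x y _)
      by (apply (is_cderive_mult (fun t => p x t) (fun t => Dy u0 x t));
          [exact py | exact uyy]).
    unfold div, vscal, grad in Eu0 |- *. simpl in Eu0 |- *.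
    rewrite (is_dx_Dx _ _ _ _ Z1), (is_dy_Dy _ _ _ _ Z2) in Eu0.
    rewrite (is_dx_Dx (fun s t => p s t * Dx u s t) x y _
      (is_dx_ext Omega (fun s t => p s t * (Dx u0 s t * U s t + u0 s t * Dx U s t))
        _ x y _ HO (fun s t H => f_equal (Cmult (p s t)) (Hux' s t H)) Hxy X1)).
    rewrite (is_dy_Dy (fun s t => p s t * Dy u s t) x y _
      (is_dy_ext Omega (fun s t => p s t * (Dy u0 s t * U s t + u0 s t * Dy U s t))
        _ x y _ HO (fun s t H => f_equal (Cmult (p s t)) (Huy' s t H)) Hxy Y1)).
    assert (Ha' : forall s t, Omega (s, t) -> p s t * (u0 s t * u0 s t) = a s t)
      by (intros s t H; rewrite (Ha s t H); simpl; ring).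
    rewrite (is_dx_Dx (fun s t => a s t * Dx U s t) x y _
      (is_dx_ext Omega (fun s t => p s t * (u0 s t * u0 s t) * Dx U s t)
        _ x y _ HO (fun s t H => f_equal (fun z => z * Dx U s t) (Ha' s t H)) Hxy X2)).
    rewrite (is_dy_Dy (fun s t => a s t * Dy U s t) x y _
      (is_dy_ext Omega (fun s t => p s t * (u0 s t * u0 s t) * Dy U s t)
        _ x y _ HO (fun s t H => f_equal (fun z => z * Dy U s t) (Ha' s t H)) Hxy Y2)).
    rewrite (Hu x y Hxy).
    (* What is left over is [u0 U] times the equation satisfied by [u0]. *)
    match type of Eu0 with ?e = _ =>
      match goal with |- ?l = ?r => replace l with (r + u0 x y * U x y * e) by ring
      end end.
    rewrite Eu0. ring. }
  split.
  - intros [_ H] x y Hxy. rewrite <- Hid by exact Hxy.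
    rewrite (H x y Hxy). ring.
  - intros H. split.
    + apply (C_diff_ext 2 Omega (fun x y => u0 x y * U x y)); trivial.
      * intros s t Hst. symmetry. apply Hu, Hst.
      * apply C_diff_mult; assumption.
    + intros x y Hxy. specialize (Hid x y Hxy). rewrite (H x y Hxy) in Hid.
      assert (Hn := Hnz x y Hxy). set (e := div _ x y + _) in *.
      replace e with (/ u0 x y * (u0 x y * e)) by (field; exact Hn).
      rewrite Hid. ring.
Qed.

(** The potential [q1] of the dual equation. *)
Definition dual_potential (p q u0 : R -> R -> C) (x y : R) : C :=
  - / p x y *
  (q x y / p x y
   + 2 * bilin (vscal (/ p x y) (grad p x y)) (vscal (/ u0 x y) (grad u0 x y))
   + 2 * bilin (vscal (/ u0 x y) (grad u0 x y))
               (vscal (/ u0 x y) (grad u0 x y))).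

Lemma is_cderive_inv_flux (p v v1 : R -> C) (t : R) (dp v2 : C) :
  p t <> 0 -> v t <> 0 ->
  is_cderive p t dp -> is_cderive v t (v1 t) -> is_cderive v1 t v2 ->
  is_cderive (fun s => / p s * (- v1 s * (/ v s * / v s))) t
    (dp * v1 t / (p t * p t * (v t * v t)) - v2 / (p t * (v t * v t))
     + 2 * v1 t * v1 t / (p t * (v t * v t * v t))).
Proof.
  intros Hpn Hvn Hp Hv Hv1. eapply is_cderive_eq.
  - apply (is_cderive_mult (fun s => / p s) (fun s => - v1 s * (/ v s * / v s))).
    + apply is_cderive_inv; [exact Hpn | exact Hp].
    + apply (is_cderive_mult (fun s => - v1 s) (fun s => / v s * / v s)).
      * apply is_cderive_opp. exact Hv1.
      * apply (is_cderive_mult (fun s => / v s) (fun s => / v s));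
          (apply is_cderive_inv; [exact Hvn | exact Hv]).
  - simpl. field. split; assumption.
Qed.

(** The potential [q1] is the one for which [1 / u0] solves the dual equation. *)
Lemma inverse_solution (Omega : R * R -> Prop) (p q u0 : R -> R -> C) :
  open Omega -> C_diff 1 Omega p ->
  (forall x y, Omega (x, y) -> p x y <> 0) ->
  solution Omega p q u0 -> (forall x y, Omega (x, y) -> u0 x y <> 0) ->
  solution Omega (fun x y => / p x y) (dual_potential p q u0)
    (fun x y => / u0 x y).
Proof.
  intros HO Hp Hpn [Hu0 Eu0] Hun. split; [apply C_diff_inv; assumption|].
  destruct (C_diff_S 0 _ _ Hp) as (dp & _).
  destruct (C_diff_S 1 _ _ Hu0) as (du & Hux & Huy).
  destruct (C_diff_S 0 _ _ Hux) as (dux & _).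
  destruct (C_diff_S 0 _ _ Huy) as (duy & _).
  intros x y Hxy. specialize (Eu0 x y Hxy).
  assert (Hpx := Hpn x y Hxy). assert (Hux0 := Hun x y Hxy).
  destruct (dp x y Hxy) as [px py]. destruct (du x y Hxy) as [ux uy].
  destruct (dux x y Hxy) as [uxx _]. destruct (duy x y Hxy) as [_ uyy].
  assert (Z1 : is_dx (fun s t => p s t * Dx u0 s t) x y _)
    by (apply (is_cderive_mult (fun s => p s y) (fun s => Dx u0 s y));
          [exact px | exact uxx]).
  assert (Z2 : is_dy (fun s t => p s t * Dy u0 s t) x y _)
    by (apply (is_cderive_mult (fun t => p x t) (fun t => Dy u0 x t));
          [exact py | exact uyy]).
  assert (Hix : forall s t, Omega (s, t) ->
    / p s t * (- Dx u0 s t * (/ u0 s t * / u0 s t))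
    = / p s t * Dx (fun a b => / u0 a b) s t).
  { intros s t H. f_equal. symmetry. apply is_dx_Dx. destruct (du s t H).
    apply (is_cderive_inv (fun s => u0 s t)); auto. }
  assert (Hiy : forall s t, Omega (s, t) ->
    / p s t * (- Dy u0 s t * (/ u0 s t * / u0 s t))
    = / p s t * Dy (fun a b => / u0 a b) s t).
  { intros s t H. f_equal. symmetry. apply is_dy_Dy. destruct (du s t H).
    apply (is_cderive_inv (fun t => u0 s t)); auto. }
  assert (X := is_dx_ext Omega _ _ x y _ HO Hix Hxy
    (is_cderive_inv_flux (fun s => p s y) (fun s => u0 s y) (fun s => Dx u0 s y)
      x _ _ Hpx Hux0 px ux uxx)).
  assert (Y := is_dy_ext Omega _ _ x y _ HO Hiy Hxy
    (is_cderive_inv_flux (fun t => p x t) (fun t => u0 x t) (fun t => Dy u0 x t)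
      y _ _ Hpx Hux0 py uy uyy)).
  unfold dual_potential, div, bilin, vscal, grad in Eu0 |- *. simpl in Eu0 |- *.
  rewrite (is_dx_Dx _ _ _ _ Z1), (is_dy_Dy _ _ _ _ Z2) in Eu0.
  rewrite (is_dx_Dx _ _ _ _ X), (is_dy_Dy _ _ _ _ Y).
  match type of Eu0 with ?e = _ =>
    match goal with |- ?l = _ =>
      replace l with (- / (p x y * p x y * (u0 x y * u0 x y)) * e)
    end end.
  - rewrite Eu0. ring.
  - field. split; assumption.
Qed.

(** If [a grad chi] is [grad phi] turned by a right angle, then
    [div (a grad chi) = 0] by the symmetry of second derivatives, so that
    [u0 chi] is a solution. The lemma is used for the equation with coefficients
    [p, q] and for its dual. *)
Lemma conjugate_solves (Omega : R * R -> Prop) (p q u0 u a b phi chi : R -> R -> C) :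
  open Omega -> C_diff 1 Omega p -> solution Omega p q u0 ->
  (forall x y, Omega (x, y) -> u0 x y <> 0) ->
  (forall x y, Omega (x, y) -> a x y = p x y * u0 x y ^ 2) ->
  (forall x y, Omega (x, y) -> a x y * b x y = 1) ->
  C_diff 2 Omega phi -> C_diff 2 Omega chi ->
  has_gradient Omega (fun x y => - (b x y * Dy phi x y))
    (fun x y => b x y * Dx phi x y) chi ->
  (forall x y, Omega (x, y) -> u x y = u0 x y * chi x y) ->
  solution Omega p q u.
Proof.
  intros HO Hp Hs Hnz Ha Hab Hphi Hchi Hgrad Hu.
  apply (solution_quotient Omega p q u0 u chi a); trivial.
  destruct (C_diff_S 1 _ _ Hphi) as (_ & Hpx & Hpy).
  destruct (C_diff_S 0 _ _ Hpx) as (dpx & _).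
  destruct (C_diff_S 0 _ _ Hpy) as (dpy & _).
  intros x y Hxy.
  rewrite (is_dx_Dx _ x y (- Dx (Dy phi) x y)).
  - rewrite (is_dy_Dy _ x y (Dy (Dx phi) x y)).
    + rewrite (Dx_Dy_comm Omega phi x y HO Hphi Hxy). ring.
    + apply (is_dy_ext Omega (Dx phi)); trivial; [|exact (proj2 (dpx x y Hxy))].
      intros s t Hst. rewrite (is_dy_Dy _ _ _ _ (proj2 (Hgrad s t Hst))).
      rewrite Cmult_assoc, Hab by exact Hst. ring.
  - apply (is_dx_ext Omega (fun s t => - Dy phi s t)); trivial.
    + intros s t Hst. rewrite (is_dx_Dx _ _ _ _ (proj1 (Hgrad s t Hst))).
      replace (a s t * - (b s t * Dy phi s t))
        with (- (a s t * b s t * Dy phi s t)) by ring.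
      rewrite Hab by exact Hst. ring.
    + apply is_cderive_opp. exact (proj1 (dpy x y Hxy)).
Qed.

Lemma dzbar_components (W : R -> R -> bicomplex) (x y : R) :
  dzbar W x y = BC
    (/ 2 * (Dx (fun a b => sc_part (W a b)) x y - Dy (fun a b => vec_part (W a b)) x y))
    (/ 2 * (Dx (fun a b => vec_part (W a b)) x y + Dy (fun a b => sc_part (W a b)) x y)).
Proof.
  unfold dzbar, bcmult, bcplus, scalar, kunit, bcDx, bcDy. simpl.
  replace (RtoC (1 / 2)%R) with (/ 2) by (rewrite RtoC_div by lra; field).
  f_equal; ring.
Qed.

Lemma dzbar_scalar (g : R -> R -> C) (x y : R) :
  dzbar (fun a b => scalar (g a b)) x y = BC (/ 2 * Dx g x y) (/ 2 * Dy g x y).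
Proof.
  rewrite dzbar_components. simpl.
  rewrite (is_dx_Dx (fun _ _ => 0) x y 0 (is_cderive_const 0 x)).
  rewrite (is_dy_Dy (fun _ _ => 0) x y 0 (is_cderive_const 0 y)).
  change (fun a b : R => g a b) with g. f_equal; ring.
Qed.

Lemma is_cderive_inv_mult (g h : R -> C) (t : R) (l m : C) :
  g t <> 0 -> is_cderive g t l -> is_cderive h t m ->
  is_cderive (fun s => / g s * h s) t (- l * (/ g t * / g t) * h t + / g t * m).
Proof.
  intros Hn Hg Hh. apply (is_cderive_mult (fun s => / g s) h); [|exact Hh].
  apply is_cderive_inv; assumption.
Qed.

(** For [W = s u + k v / s] with [s^2 = p], the Vekua equation is the system
    [(u0 v)_x = - p u0^2 (u / u0)_y], [(u0 v)_y = p u0^2 (u / u0)_x]. *)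
Lemma vekua_conjugate (Omega : R * R -> Prop) (p u0 s u v : R -> R -> C) :
  open Omega ->
  C_diff 2 Omega u0 -> (forall x y, Omega (x, y) -> u0 x y <> 0) ->
  C_diff 2 Omega s -> (forall x y, Omega (x, y) -> s x y ^ 2 = p x y) ->
  (forall x y, Omega (x, y) -> s x y <> 0) ->
  C_diff 2 Omega u -> C_diff 2 Omega v ->
  (vekua_solution Omega (fun x y => s x y * u0 x y)
     (fun x y => scalar (s x y * u x y) + kunit * scalar (/ s x y * v x y))%BC <->
   has_gradient Omega
     (fun x y => - (p x y * u0 x y ^ 2 * Dy (fun a b => / u0 a b * u a b) x y))
     (fun x y => p x y * u0 x y ^ 2 * Dx (fun a b => / u0 a b * u a b) x y)
     (fun x y => u0 x y * v x y)).
Proof.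
  intros HO Hu0 Hun Hs Hsp Hsn Hu Hv.
  set (W := fun x y => (scalar (s x y * u x y) + kunit * scalar (/ s x y * v x y))%BC).
  assert (EW : forall x y, W x y = BC (s x y * u x y) (/ s x y * v x y)).
  { intros x y. unfold W, bcplus, bcmult, scalar, kunit. simpl. f_equal; ring. }
  assert (H1 : C_diff 2 Omega (fun x y => s x y * u x y)) by (apply C_diff_mult; auto).
  assert (H2 : C_diff 2 Omega (fun x y => / s x y * v x y))
    by (apply C_diff_mult; auto; apply C_diff_inv; auto).
  assert (HU : C_diff 2 Omega (fun x y => / u0 x y * u x y))
    by (apply C_diff_mult; auto; apply C_diff_inv; auto).
  assert (HV : C_diff 2 Omega (fun x y => u0 x y * v x y))
    by (apply C_diff_mult; auto).
  destruct (C_diff_S 1 _ _ Hu0) as (du0 & _).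
  destruct (C_diff_S 1 _ _ Hs) as (ds & _).
  destruct (C_diff_S 1 _ _ Hu) as (du & _).
  destruct (C_diff_S 1 _ _ Hv) as (dv & _).
  destruct (C_diff_S 1 _ _ HV) as (dV & _).
  set (U := fun x y => / u0 x y * u x y) in *.
  set (V := fun x y => u0 x y * v x y) in *.
  assert (Hpt : forall x y, Omega (x, y) ->
    (dzbar W x y = (dzbar (fun a b => scalar (s a b * u0 a b)) x y
        * scalar (/ (s x y * u0 x y)) * bcconj (W x y))%BC <->
     Dx V x y = - (p x y * u0 x y ^ 2 * Dy U x y) /\
     Dy V x y = p x y * u0 x y ^ 2 * Dx U x y)).
  { intros x y Hxy. rewrite dzbar_components, dzbar_scalar, EW.
    destruct (du0 x y Hxy) as [u0x u0y]. destruct (ds x y Hxy) as [sx sy].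
    destruct (du x y Hxy) as [ux uy]. destruct (dv x y Hxy) as [vx vy].
    assert (Hn := Hun x y Hxy). assert (Hn' := Hsn x y Hxy).
    assert (E1x : Dx (fun a b => sc_part (W a b)) x y
      = Dx s x y * u x y + s x y * Dx u x y).
    { apply is_dx_Dx. apply (is_dx_ext Omega (fun a b => s a b * u a b)); trivial.
      - intros a b _. rewrite EW. reflexivity.
      - apply (is_cderive_mult (fun a => s a y) (fun a => u a y)); [exact sx | exact ux]. }
    assert (E1y : Dy (fun a b => sc_part (W a b)) x y
      = Dy s x y * u x y + s x y * Dy u x y).
    { apply is_dy_Dy. apply (is_dy_ext Omega (fun a b => s a b * u a b)); trivial.
      - intros a b _. rewrite EW. reflexivity.
      - apply (is_cderive_mult (fun b => s x b) (fun b => u x b)); [exact sy | exact uy]. }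
    assert (E2x : Dx (fun a b => vec_part (W a b)) x y
      = - Dx s x y * (/ s x y * / s x y) * v x y + / s x y * Dx v x y).
    { apply is_dx_Dx. apply (is_dx_ext Omega (fun a b => / s a b * v a b)); trivial.
      - intros a b _. rewrite EW. reflexivity.
      - apply (is_cderive_inv_mult (fun a => s a y) (fun a => v a y));
          [exact Hn' | exact sx | exact vx]. }
    assert (E2y : Dy (fun a b => vec_part (W a b)) x y
      = - Dy s x y * (/ s x y * / s x y) * v x y + / s x y * Dy v x y).
    { apply is_dy_Dy. apply (is_dy_ext Omega (fun a b => / s a b * v a b)); trivial.
      - intros a b _. rewrite EW. reflexivity.
      - apply (is_cderive_inv_mult (fun b => s x b) (fun b => v x b));
          [exact Hn' | exact sy | exact vy]. }
    assert (Efx : Dx (fun a b => s a b * u0 a b) x y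
      = Dx s x y * u0 x y + s x y * Dx u0 x y).
    { apply is_dx_Dx.
      apply (is_cderive_mult (fun a => s a y) (fun a => u0 a y)); [exact sx | exact u0x]. }
    assert (Efy : Dy (fun a b => s a b * u0 a b) x y
      = Dy s x y * u0 x y + s x y * Dy u0 x y).
    { apply is_dy_Dy.
      apply (is_cderive_mult (fun b => s x b) (fun b => u0 x b)); [exact sy | exact u0y]. }
    assert (EUx : Dx U x y
      = - Dx u0 x y * (/ u0 x y * / u0 x y) * u x y + / u0 x y * Dx u x y).
    { apply is_dx_Dx. apply (is_cderive_inv_mult (fun a => u0 a y) (fun a => u a y));
        [exact Hn | exact u0x | exact ux]. }
    assert (EUy : Dy U x y
      = - Dy u0 x y * (/ u0 x y * / u0 x y) * u x y + / u0 x y * Dy u x y).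
    { apply is_dy_Dy. apply (is_cderive_inv_mult (fun b => u0 x b) (fun b => u x b));
        [exact Hn | exact u0y | exact uy]. }
    assert (EVx : Dx V x y = Dx u0 x y * v x y + u0 x y * Dx v x y).
    { apply is_dx_Dx. apply (is_cderive_mult (fun a => u0 a y) (fun a => v a y));
        [exact u0x | exact vx]. }
    assert (EVy : Dy V x y = Dy u0 x y * v x y + u0 x y * Dy v x y).
    { apply is_dy_Dy. apply (is_cderive_mult (fun b => u0 x b) (fun b => v x b));
        [exact u0y | exact vy]. }
    rewrite E1x, E1y, E2x, E2y, Efx, Efy, EUx, EUy, EVx, EVy.
    rewrite <- (Hsp x y Hxy).
    unfold bcmult, bcconj, scalar. cbn [sc_part vec_part].
    (* In each component, the difference of the sides of the Vekua equation is
       [1 / (2 s u0)] times that of an equation of the system. *)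
    assert (Hk : / (2 * (s x y * u0 x y)) <> 0).
    { intros E. apply C1_nz.
      rewrite <- (Cinv_l (2 * (s x y * u0 x y))); [rewrite E; ring|].
      repeat apply Cmult_neq_0; trivial. intros E2. apply RtoC_inj in E2. lra. }
    match goal with |- BC ?a ?b = BC ?c ?d <-> ?e = ?f /\ ?g = ?h =>
      assert (I1 : a = c <-> h = g); [| assert (I2 : b = d <-> e = f);
      [| split; [intros E; split; [apply I2, (f_equal vec_part E)
           | symmetry; apply I1, (f_equal sc_part E)] | intros [h1 h2];
         f_equal; [apply I1; auto | apply I2; auto]]]]
    end.
    - apply (Cmult_sub_eq_iff _ _ _ _ _ Hk). simpl. field. split; assumption.
    - apply (Cmult_sub_eq_iff _ _ _ _ _ Hk). simpl. field. split; assumption. }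
  split.
  - intros (_ & _ & H) x y Hxy. destruct (proj1 (Hpt x y Hxy) (H x y Hxy)) as [<- <-].
    apply dV, Hxy.
  - intros H. split; [|split].
    + apply (C_diff_ext 2 Omega (fun x y => s x y * u x y)); trivial.
      intros a b _. rewrite EW. reflexivity.
    + apply (C_diff_ext 2 Omega (fun x y => / s x y * v x y)); trivial.
      intros a b _. rewrite EW. reflexivity.
    + intros x y Hxy. apply Hpt; trivial. destruct (H x y Hxy) as [Hx Hy].
      split; [apply is_dx_Dx | apply is_dy_Dy]; assumption.
Qed.

(** * Conjugate solutions and the operator A-bar *)

(** When [div (a grad U) = 0], the family A-bar of
    [k a dzbar U] consists of the functions with gradient [(- a U_y, a U_x)]. *)
Lemma Abar_conjugate (Omega : R * R -> Prop) (x0 y0 : R)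
    (Phi : R -> R -> bicomplex) (a U : R -> R -> C) :
  simply_connected_domain Omega -> Omega (x0, y0) ->
  C_diff 1 Omega a -> C_diff 2 Omega U ->
  (forall x y, Omega (x, y) ->
     Dx (fun s t => a s t * Dx U s t) x y
     + Dy (fun s t => a s t * Dy U s t) x y = 0) ->
  (forall x y,
     Phi x y = BC (- (/ 2 * (a x y * Dy U x y))) (/ 2 * (a x y * Dx U x y))) ->
  (exists phi, Abar Omega x0 y0 Phi phi) /\
  forall phi, Abar Omega x0 y0 Phi phi <->
    has_gradient Omega (fun x y => - (a x y * Dy U x y))
      (fun x y => a x y * Dx U x y) phi.
Proof.
  intros Hsc H0 Ha HU Hdiv HPhi. assert (HO := proj1 Hsc).
  destruct (C_diff_S 1 _ _ HU) as (_ & HUx & HUy).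
  assert (H1 : C_diff 1 Omega (fun x y => a x y * Dx U x y))
    by (apply C_diff_mult; assumption).
  assert (H2 : C_diff 1 Omega (fun x y => a x y * Dy U x y))
    by (apply C_diff_mult; assumption).
  destruct (C_diff_S 0 _ _ H1) as (d1 & _).
  destruct (C_diff_S 0 _ _ H2) as (d2 & _).
  assert (Hscale : forall (g : R -> R -> C) x y l, is_cderive (fun s => g s y) x l ->
    is_cderive (fun s => / 2 * g s y) x (/ 2 * l)).
  { intros g x y l H. replace (/ 2 * l) with (0 * g x y + / 2 * l) by ring.
    apply (is_cderive_mult (fun _ => / 2) (fun s => g s y)); [|exact H].
    apply is_cderive_const. }
  assert (Hcomp : compatible Omega Phi).
  { split; [|split].
    - apply (C_diff_ext 1 Omega (fun x y => - (/ 2 * (a x y * Dy U x y)))); trivial.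
      + intros x y _. rewrite HPhi. reflexivity.
      + apply C_diff_opp, C_diff_mult; trivial. apply C_diff_const, HO.
    - apply (C_diff_ext 1 Omega (fun x y => / 2 * (a x y * Dx U x y))); trivial.
      + intros x y _. rewrite HPhi. reflexivity.
      + apply C_diff_mult; trivial. apply C_diff_const, HO.
    - intros x y Hxy. specialize (Hdiv x y Hxy).
      rewrite (is_dy_Dy _ x y
        (- (/ 2 * Dy (fun s t => a s t * Dy U s t) x y))).
      2: { apply (is_dy_ext Omega (fun x y => - (/ 2 * (a x y * Dy U x y)))); trivial.
           - intros s t _. rewrite HPhi. reflexivity.
           - apply is_cderive_opp.
             apply (Hscale (fun t s => a s t * Dy U s t)). exact (proj2 (d2 x y Hxy)). }
      rewrite (is_dx_Dx _ x y (/ 2 * Dx (fun s t => a s t * Dx U s t) x y)).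
      2: { apply (is_dx_ext Omega (fun x y => / 2 * (a x y * Dx U x y))); trivial.
           - intros s t _. rewrite HPhi. reflexivity.
           - apply (Hscale (fun s t => a s t * Dx U s t)). exact (proj1 (d1 x y Hxy)). }
      match type of Hdiv with ?l = _ => transitivity (- / 2 * l) end; [ring|].
      rewrite Hdiv. ring. }
  split; [apply Abar_exists; assumption|].
  intros phi. rewrite (Abar_gradient Omega x0 y0 Phi phi Hsc H0 Hcomp).
  split; apply has_gradient_ext; trivial; intros x y _; rewrite HPhi; simpl; field.
Qed.

Lemma Cpow2_neq_0 (z : C) : z <> 0 -> z ^ 2 <> 0.
Proof.
  intros H. simpl. rewrite Cmult_1_r. apply Cmult_neq_0; exact H.
Qed.

Lemma Cinv_neq_0 (z : C) : z <> 0 -> / z <> 0.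
Proof.
  intros H E. apply C1_nz. rewrite <- (Cinv_l z H), E. ring.
Qed.

(** The right-hand side alone makes [v] twice continuously differentiable and
    a solution of the dual equation. *)
Lemma conjugate_iff (Omega : R * R -> Prop) (p q u0 s u v : R -> R -> C) :
  open Omega -> C_diff 2 Omega p -> (forall x y, Omega (x, y) -> p x y <> 0) ->
  solution Omega p q u0 -> (forall x y, Omega (x, y) -> u0 x y <> 0) ->
  C_diff 2 Omega s -> (forall x y, Omega (x, y) -> s x y ^ 2 = p x y) ->
  C_diff 2 Omega u ->
  (solution Omega (fun x y => / p x y) (dual_potential p q u0) v /\
   vekua_solution Omega (fun x y => s x y * u0 x y)
     (fun x y => scalar (s x y * u x y) + kunit * scalar (/ s x y * v x y))%BC <->
   has_gradient Omega
     (fun x y => - (p x y * u0 x y ^ 2 * Dy (fun a b => / u0 a b * u a b) x y))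
     (fun x y => p x y * u0 x y ^ 2 * Dx (fun a b => / u0 a b * u a b) x y)
     (fun x y => u0 x y * v x y)).
Proof.
  intros HO Hp Hpn Hs0 Hun Hs Hsp Hu.
  assert (Hsn : forall x y, Omega (x, y) -> s x y <> 0).
  { intros x y Hxy E. apply (Hpn x y Hxy). rewrite <- Hsp, E by exact Hxy.
    simpl. ring. }
  assert (Hp1 := C_diff_le 2 1 _ _ (le_S _ _ (le_n 1)) Hp).
  assert (Hinv := inverse_solution Omega p q u0 HO Hp1 Hpn Hs0 Hun).
  assert (Hu0 := proj1 Hs0).
  assert (HU : C_diff 2 Omega (fun x y => / u0 x y * u x y))
    by (apply C_diff_mult; auto; apply C_diff_inv; auto).
  set (U := fun x y => / u0 x y * u x y) in *.
  split.
  - intros [[Hv _] Hvek].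
    apply (vekua_conjugate Omega p u0 s u v) in Hvek; assumption.
  - intros Hgrad.
    destruct (C_diff_S 1 _ _ HU) as (_ & HUx & HUy).
    assert (Ha : C_diff 1 Omega (fun x y => p x y * u0 x y ^ 2)).
    { apply (C_diff_le 2); [lia|]. simpl.
      repeat apply C_diff_mult; auto. apply C_diff_const, HO. }
    assert (HV : C_diff 2 Omega (fun x y => u0 x y * v x y)).
    { apply (has_gradient_C_diff 1 Omega _ _ _ HO Hgrad).
      - apply C_diff_opp, C_diff_mult; assumption.
      - apply C_diff_mult; assumption. }
    assert (Hv' : forall x y, Omega (x, y) -> v x y = / u0 x y * (u0 x y * v x y))
      by (intros x y Hxy; field; auto).
    assert (Hv : C_diff 2 Omega v).
    { apply (C_diff_ext 2 Omega (fun x y => / u0 x y * (u0 x y * v x y))); trivial.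
      - intros x y Hxy. symmetry. auto.
      - apply C_diff_mult; trivial. apply C_diff_inv; assumption. }
    split.
    + apply (conjugate_solves Omega (fun x y => / p x y) _ (fun x y => / u0 x y) v
        (fun x y => / p x y * (/ u0 x y) ^ 2) (fun x y => p x y * u0 x y ^ 2)
        U (fun x y => u0 x y * v x y)); trivial.
      * apply C_diff_inv; assumption.
      * intros x y Hxy. apply Cinv_neq_0. auto.
      * intros x y Hxy. simpl. field. split; auto.
    + apply (vekua_conjugate Omega p u0 s u v); assumption.
Qed.

(** The system of [vekua_conjugate] solved for the gradient of [- u / u0]. *)
Lemma coconjugate_iff (Omega : R * R -> Prop) (p q u0 s u v : R -> R -> C) :
  open Omega -> C_diff 2 Omega p -> (forall x y, Omega (x, y) -> p x y <> 0) ->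
  solution Omega p q u0 -> (forall x y, Omega (x, y) -> u0 x y <> 0) ->
  C_diff 2 Omega s -> (forall x y, Omega (x, y) -> s x y ^ 2 = p x y) ->
  C_diff 2 Omega v ->
  (solution Omega p q u /\
   vekua_solution Omega (fun x y => s x y * u0 x y)
     (fun x y => scalar (s x y * u x y) + kunit * scalar (/ s x y * v x y))%BC <->
   has_gradient Omega
     (fun x y => - (/ p x y * / (u0 x y ^ 2) * Dy (fun a b => u0 a b * v a b) x y))
     (fun x y => / p x y * / (u0 x y ^ 2) * Dx (fun a b => u0 a b * v a b) x y)
     (fun x y => - (/ u0 x y * u x y))).
Proof.
  intros HO Hp Hpn Hs0 Hun Hs Hsp Hv.
  assert (Hsn : forall x y, Omega (x, y) -> s x y <> 0).
  { intros x y Hxy E. apply (Hpn x y Hxy). rewrite <- Hsp, E by exact Hxy.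
    simpl. ring. }
  assert (Hp1 := C_diff_le 2 1 _ _ (le_S _ _ (le_n 1)) Hp).
  assert (Hu0 := proj1 Hs0).
  assert (HV : C_diff 2 Omega (fun x y => u0 x y * v x y))
    by (apply C_diff_mult; auto).
  destruct (C_diff_S 1 _ _ HV) as (dV & HVx & HVy).
  set (V := fun x y => u0 x y * v x y) in *.
  split.
  - intros [[Hu _] Hvek].
    apply (vekua_conjugate Omega p u0 s u v) in Hvek; trivial. fold V in Hvek.
    assert (HU : C_diff 2 Omega (fun x y => / u0 x y * u x y))
      by (apply C_diff_mult; auto; apply C_diff_inv; auto).
    destruct (C_diff_S 1 _ _ HU) as (dU & _).
    intros x y Hxy. destruct (Hvek x y Hxy) as [Vx Vy]. destruct (dU x y Hxy) as [Ux Uy].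
    assert (Hn := Hpn x y Hxy). assert (Hn' := Hun x y Hxy).
    rewrite (is_dx_Dx _ _ _ _ Vx), (is_dy_Dy _ _ _ _ Vy).
    split; (eapply is_cderive_eq; [apply is_cderive_opp; eassumption|]);
      simpl; field; auto.
  - intros Hgrad.
    assert (Hb : C_diff 1 Omega (fun x y => / p x y * / (u0 x y ^ 2))).
    { apply (C_diff_le 2); [lia|]. apply C_diff_mult; trivial.
      - apply C_diff_inv; assumption.
      - apply C_diff_inv; trivial.
        + intros x y Hxy. apply Cpow2_neq_0. auto.
        + simpl. repeat apply C_diff_mult; auto. apply C_diff_const, HO. }
    assert (HnU : C_diff 2 Omega (fun x y => - (/ u0 x y * u x y))).
    { apply (has_gradient_C_diff 1 Omega _ _ _ HO Hgrad).
      - apply C_diff_opp, C_diff_mult; assumption.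
      - apply C_diff_mult; assumption. }
    assert (HU : C_diff 2 Omega (fun x y => / u0 x y * u x y)).
    { apply (C_diff_ext 2 Omega (fun x y => - - (/ u0 x y * u x y))); trivial.
      - intros x y _. ring.
      - apply (C_diff_opp 2 Omega (fun x y => - (/ u0 x y * u x y))); trivial. }
    assert (HgU : has_gradient Omega
      (fun x y => / p x y * / (u0 x y ^ 2) * Dy V x y)
      (fun x y => - (/ p x y * / (u0 x y ^ 2) * Dx V x y))
      (fun x y => / u0 x y * u x y)).
    { apply (has_gradient_scale Omega (- (1))) in Hgrad. revert Hgrad.
      apply has_gradient_ext; trivial; intros x y _; ring. }
    assert (Hu' : forall x y, Omega (x, y) -> u x y = u0 x y * (/ u0 x y * u x y))
      by (intros x y Hxy; field; auto).
    assert (Hu : C_diff 2 Omega u).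
    { apply (C_diff_ext 2 Omega (fun x y => u0 x y * (/ u0 x y * u x y))); trivial.
      - intros x y Hxy. symmetry. auto.
      - apply C_diff_mult; trivial. }
    split.
    + apply (conjugate_solves Omega p q u0 u (fun x y => p x y * u0 x y ^ 2)
        (fun x y => / p x y * / (u0 x y ^ 2)) (fun x y => - V x y)
        (fun x y => / u0 x y * u x y)); trivial.
      * intros x y Hxy. simpl. field. split; auto.
      * apply C_diff_opp; assumption.
      * revert HgU. apply has_gradient_ext; trivial; intros x y Hxy;
          destruct (dV x y Hxy) as [Vx Vy].
        -- rewrite (is_dy_Dy (fun x y => - V x y) x y (- Dy V x y))
             by (apply is_cderive_opp; exact Vy). ring.
        -- rewrite (is_dx_Dx (fun x y => - V x y) x y (- Dx V x y))
             by (apply is_cderive_opp; exact Vx). ring.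
    + apply (vekua_conjugate Omega p u0 s u v); trivial. fold V.
      intros x y Hxy. destruct (HgU x y Hxy) as [Ux Uy]. destruct (dV x y Hxy) as [Vx Vy].
      assert (Hn := Hpn x y Hxy). assert (Hn' := Hun x y Hxy).
      rewrite (is_dx_Dx _ _ _ _ Ux), (is_dy_Dy _ _ _ _ Uy).
      split; (eapply is_cderive_eq; [eassumption|]); simpl; field; auto.
Qed.

Theorem corollary13 :
  forall (Omega : R * R -> Prop) (p q u0 sqrtp : R -> R -> C) (x0 y0 : R),
  simply_connected_domain Omega ->
  C_diff 2 Omega p ->
  (forall x y : R, Omega (x, y) -> p x y <> 0) ->
  solution Omega p q u0 ->
  (forall x y : R, Omega (x, y) -> u0 x y <> 0) ->
  C_diff 2 Omega sqrtp ->
  (forall x y : R, Omega (x, y) -> sqrtp x y ^ 2 = p x y) ->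
  Omega (x0, y0) ->
  let f : R -> R -> C := fun x y => sqrtp x y * u0 x y in
  let q1 : R -> R -> C := fun x y =>
    - / p x y *
      (q x y / p x y
       + 2 * bilin (vscal (/ p x y) (grad p x y)) (vscal (/ u0 x y) (grad u0 x y))
       + 2 * bilin (vscal (/ u0 x y) (grad u0 x y))
                   (vscal (/ u0 x y) (grad u0 x y))) in
  let W (u v : R -> R -> C) : R -> R -> bicomplex := fun x y =>
    (scalar (sqrtp x y * u x y) + kunit * scalar (/ sqrtp x y * v x y))%BC in
  (* solutions v corresponding to a given u *)
  let conjugate (u v : R -> R -> C) : Prop :=
    solution Omega (fun x y => / p x y) q1 v /\
    vekua_solution Omega f (W u v) in
  (* solutions u corresponding to a given v *)
  let coconjugate (v u : R -> R -> C) : Prop :=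
    solution Omega p q u /\
    vekua_solution Omega f (W u v) in
  (forall u : R -> R -> C, solution Omega p q u ->
     let Phi : R -> R -> bicomplex := fun x y =>
       (kunit * scalar (p x y * u0 x y ^ 2)
        * dzbar (fun a b => scalar (/ u0 a b * u a b)) x y)%BC in
     (exists phi : R -> R -> C, Abar Omega x0 y0 Phi phi) /\
     (forall v : R -> R -> C,
        conjugate u v <->
        exists phi : R -> R -> C, Abar Omega x0 y0 Phi phi /\
          forall x y : R, Omega (x, y) -> v x y = / u0 x y * phi x y) /\
     (forall v w : R -> R -> C, conjugate u v ->
        (conjugate u w <->
         exists c : C, forall x y : R, Omega (x, y) ->
           w x y = v x y + c * / u0 x y))) /\
  (forall v : R -> R -> C, solution Omega (fun x y => / p x y) q1 v ->
     let Psi : R -> R -> bicomplex := fun x y =>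
       (kunit * scalar (/ p x y * / (u0 x y ^ 2))
        * dzbar (fun a b => scalar (u0 a b * v a b)) x y)%BC in
     (exists phi : R -> R -> C, Abar Omega x0 y0 Psi phi) /\
     (forall u : R -> R -> C,
        coconjugate v u <->
        exists phi : R -> R -> C, Abar Omega x0 y0 Psi phi /\
          forall x y : R, Omega (x, y) -> u x y = - u0 x y * phi x y)).
Proof.
  intros Omega p q u0 s x0 y0 Hsc Hp Hpn Hs0 Hun Hs Hsp H0 f q1 W conjugate coconjugate.
  pose proof Hsc as (HO & _ & Hpc & _). assert (Hu0 := proj1 Hs0).
  assert (Hp1 := C_diff_le 2 1 _ _ (le_S _ _ (le_n 1)) Hp).
  assert (Ha : C_diff 1 Omega (fun x y => p x y * u0 x y ^ 2)).
  { apply (C_diff_le 2); [lia|]. simpl.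
    repeat apply C_diff_mult; auto. apply C_diff_const, HO. }
  assert (Hb : C_diff 1 Omega (fun x y => / p x y * / (u0 x y ^ 2))).
  { apply (C_diff_le 2); [lia|]. apply C_diff_mult; trivial.
    - apply C_diff_inv; assumption.
    - apply C_diff_inv; trivial.
      + intros x y Hxy. apply Cpow2_neq_0. auto.
      + simpl. repeat apply C_diff_mult; auto. apply C_diff_const, HO. }
  split.
  - intros u Hu Phi.
    assert (HU : C_diff 2 Omega (fun x y => / u0 x y * u x y))
      by (apply C_diff_mult; auto; [apply C_diff_inv; auto | apply Hu]).
    assert (Hconj : forall v, conjugate u v <-> _)
      by (intros v; apply (conjugate_iff Omega p q u0 s u v); trivial; apply Hu).
    destruct (Abar_conjugate Omega x0 y0 Phi (fun x y => p x y * u0 x y ^ 2)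
      (fun x y => / u0 x y * u x y)) as [Hex Hiff]; trivial.
    { apply (solution_quotient Omega p q u0 u); trivial.
      intros x y Hxy. field. auto. }
    { intros x y. unfold Phi. rewrite dzbar_scalar.
      unfold bcmult, kunit, scalar. simpl. f_equal; ring. }
    set (P := fun x y : R => - _) in *. set (Q := fun x y : R => _ * Dx _ x y) in *.
    split; [exact Hex|]. split.
    + intros v. rewrite Hconj. split.
      * intros Hg. exists (fun x y => u0 x y * v x y). split; [apply Hiff, Hg|].
        intros x y Hxy. field. auto.
      * intros (phi & Hphi & Hv). apply Hiff in Hphi. revert Hphi.
        apply has_gradient_ext; trivial. intros x y Hxy. rewrite Hv by exact Hxy.
        field. auto.
    + intros v w Hv. apply Hconj in Hv. rewrite Hconj. split.
      (* [u0 v] and [u0 w] have the same gradient. *)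
      * intros Hw. exists (u0 x0 y0 * w x0 y0 - u0 x0 y0 * v x0 y0).
        intros x y Hxy.
        destruct (C_diff_S 1 _ _ HU) as (_ & HUx & HUy).
        assert (E := has_gradient_unique Omega P Q _ _ x0 y0 x y HO Hpc
          (C_diff_le 1 0 _ _ (Nat.le_0_l _)
            (C_diff_opp 1 Omega _ HO (C_diff_mult 1 Omega _ _ HO Ha HUy)))
          (C_diff_le 1 0 _ _ (Nat.le_0_l _) (C_diff_mult 1 Omega _ _ HO Ha HUx))
          Hw Hv H0 Hxy). simpl in E.
        replace (u0 x0 y0 * w x0 y0 - u0 x0 y0 * v x0 y0)
          with (u0 x y * w x y - u0 x y * v x y
            - ((u0 x y * w x y - u0 x0 y0 * w x0 y0)
               - (u0 x y * v x y - u0 x0 y0 * v x0 y0))) by ring.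
        rewrite E. field. auto.
      * intros [c Hc]. apply (has_gradient_add_const Omega c) in Hv. revert Hv.
        apply has_gradient_ext; trivial. intros x y Hxy. rewrite Hc by exact Hxy.
        field. auto.
  - intros v Hv Psi.
    assert (Hco : forall u, coconjugate v u <-> _)
      by (intros u; apply (coconjugate_iff Omega p q u0 s u v); trivial; apply Hv).
    assert (HV : C_diff 2 Omega (fun x y => u0 x y * v x y))
      by (apply C_diff_mult; auto; apply Hv).
    destruct (Abar_conjugate Omega x0 y0 Psi (fun x y => / p x y * / (u0 x y ^ 2))
      (fun x y => u0 x y * v x y)) as [Hex Hiff]; trivial.
    { apply (solution_quotient Omega (fun x y => / p x y) q1 (fun x y => / u0 x y) v);
        trivial.
      - apply C_diff_inv; assumption.
      - apply inverse_solution; assumption.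
      - intros x y Hxy. apply Cinv_neq_0. auto.
      - intros x y Hxy. field. auto.
      - intros x y Hxy. simpl. field. auto. }
    { intros x y. unfold Psi. rewrite dzbar_scalar.
      unfold bcmult, kunit, scalar. simpl. f_equal; ring. }
    split; [exact Hex|]. intros u. rewrite Hco. split.
    + intros Hg. exists (fun x y => - (/ u0 x y * u x y)). split; [apply Hiff, Hg|].
      intros x y Hxy. field. auto.
    + intros (phi & Hphi & Hu). apply Hiff in Hphi. revert Hphi.
      apply has_gradient_ext; trivial. intros x y Hxy. rewrite Hu by exact Hxy.
      field. auto.
Qed.
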